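(* Let $\lambda$ be a partition, let $n\ge \ell(\lambda)$, and let $M\in\mathrm{MLQ}(\lambda,n)$. Then \[\operatorname{maj}(M)=\operatorname{charge}(\rho_Q(M)).\]
   Context: Partitions and tableaux. For a partition $\lambda$, $\lambda'$ is its conjugate ($\lambda'_i=\#\{j:\lambda_j\ge i\}$) and $\ell(\lambda)$ its number of nonzero parts. Young diagrams are in French notation: row 1 is at the bottom, row $i$ has $\lambda_i$ left-justified boxes. A semistandard Young tableau (SSYT) of shape $\lambda$ is a filling by positive integers weakly increasing left to right in rows and strictly increasing bottom to top in columns; its content is $(c_1,c_2,\dots)$ with $c_i$ the number of entries $i$. The row reading word $\mathrm{rrw}(T)$ reads the rows from top to bottom, each row left to right. Binary matrices and multiline queues. For positive integers $L,n$, $\mathcal M(L,n)$ is the set of tuples $B=(B_1,\dots,B_L)$ of subsets of $[n]$, drawn as an $L\times n$ grid with rows $1,\dots,L$ from bottom to top, columns $1,\dots,n$ from left to right, and a ball in cell $(r,j)$ iff $j\in B_r$. For a partition $\lambda$ with $L=\lambda_1$ and $n\ge\ell(\lambda)$, $\mathrm{MLQ}(\lambda,n)$ is the set of $B\in\mathcal M(L,n)$ with $|B_j|=\lambda'_j$ for all $j$. A binary matrix whose top rows are empty is identified with the tuple obtained by deleting those empty rows. The column word $\mathrm{cw}(B)$ scans columns from left to right and, within each column, cells from top to bottom, recording the row number of each ball. Bracketing. For a word $w$ in positive integers and $i\ge1$, $\mathrm{Par}_i(w)$ is obtained by reading $w$ left to right, writing ''('' for each letter $i+1$ and '')'' for each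 letter $i$ (other letters ignored), and iteratively matching a ''('' with a '')'' to its right whenever they are adjacent or only already-matched parentheses lie between them. Letters $i,i+1$ of $w$ whose parentheses remain unmatched are called unmatched. Ferrari–Martin labelling and major index. Let $M\in\mathrm{MLQ}(\lambda,n)$, $L=\lambda_1$. For $r=L,L-1,\dots,2$: every not-yet-labelled ball of row $r$ receives label $r$; then the balls of row $r$ are processed in order of decreasing label (left to right among equal labels), each being paired with the first not-yet-labelled ball of row $r-1$ weakly to its right, scanning cyclically (columns $j,j+1,\dots,n,1,2,\dots$); that ball receives the same label. A pairing wraps if the ball found in row $r-1$ lies in a column strictly left of the ball in row $r$. Finally unlabelled balls of row 1 get label 1. Then $\operatorname{maj}(M)=\sum_p(\ell(p)-r(p)+1)$ over all wrapping pairings $p$, where $r(p)$ is the row of the upper ball of $p$ and $\ell(p)$ its label. $M$ is nonwrapping if $\operatorname{maj}(M)=0$; $\mathrm{MLQ}_0(\lambda,n)$ denotes the set of nonwrapping elements of $\mathrm{MLQ}(\lambda,n)$. Charge. The charge of a permutation $\tau$ of $[m]$ in one-line notation is $\sum (m-i)$ over those $i\in[m-1]$ such that $i$ appears to the left of $i+1$ in $\tau$. A word $w$ has partition content $\mu$ if its letters are $1,\dots,k$ and the number $\mu_i$ of letters $i$ satisfies $\mu_1\ge\mu_2\ge\cdots$. Its charge subwords are extracted as follows: scan $w$ from left to right to find the leftmost occurrence of its largest letter $k$, then continue to the right cyclically (wrapping to the start when needed) to find the next occurrence of $k-1$, then of $k-2$, and so on down to $1$; these $k$ letters, in their order of position in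 $w$, form $w^{(1)}$, viewed as a permutation of $[k]$. Remove them and repeat on the remaining letters to get $w^{(2)},w^{(3)},\dots$. Then $\operatorname{charge}(w)=\sum_i\operatorname{charge}(w^{(i)})$. For a SSYT $T$ with partition content, $\operatorname{charge}(T)=\operatorname{charge}(\mathrm{rrw}(T))$. Collapsing. For $B\in\mathcal M(L,n)$ and $1\le i\le L-1$, a ball in row $i+1$ is unmatched above if its letter $i+1$ in $\mathrm{cw}(B)$ is unmatched in $\mathrm{Par}_i(\mathrm{cw}(B))$. The operator $e_i^\star$ moves every ball of row $i+1$ that is unmatched above down to the (necessarily empty) cell of row $i$ in the same column. Products of operators act right to left, and $e^\star_{[a,b]}=e^\star_a e^\star_{a+1}\cdots e^\star_b$. Define $\rho_N(B)=e^\star_{[1,L-1]}e^\star_{[1,L-2]}\cdots e^\star_{[1,1]}(B)$. For $1\le k\le L$ let $N^{(k)}$ be the bottom $k$ rows of $e^\star_{[1,k-1]}\cdots e^\star_{[1,1]}(B)$ (so $N^{(1)}=(B_1)$), and let $N^{(0)}$ be empty. The recording tableau $\rho_Q(B)$ is the filling whose row $r$ (from the bottom) contains, for each $i=1,\dots,L$, exactly $|N^{(i)}_r|-|N^{(i-1)}_r|$ entries equal to $i$ (with $|N^{(i-1)}_i|=0$), arranged weakly increasingly; $\rho(B)=(\rho_N(B),\rho_Q(B))$. *)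

(* Defs.v *)
From mathcomp Require Import all_boot.

Set Implicit Arguments.
Unset Strict Implicit.
Unset Printing Implicit Defensive.

(* ell(la) = size la, la_1 = head 0 la.                              *)
Definition is_partition (la : seq nat) : bool :=
  sorted geq la && all (fun x => 0 < x) la.

Definition conjp (la : seq nat) (j : nat) : nat := count (fun x => j <= x) la.

(* Binary matrices: B : seq (seq bool); row r (1-based, bottom = 1)  *)
(* is nth [::] B r.-1, and cell (r,j) (1-based column) holds a ball  *)
(* iff nth false (row r) j.-1.  B in M(L,n) has L = size B rows,     *)
(* each of size n.                                                   *)
Definition brow (B : seq (seq bool)) (r : nat) : seq bool := nth [::] B r.-1.
Definition cell (B : seq (seq bool)) (r j : nat) : bool := nth false (brow B r) j.-1.

Definition is_matrix (n : nat) (B : seq (seq bool)) : bool :=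
  all (fun row => size row == n) B.

Definition is_MLQ (la : seq nat) (n : nat) (B : seq (seq bool)) : bool :=
  [&& size B == head 0 la, is_matrix n B &
      all (fun j => count id (brow B j) == conjp la j) (iota 1 (head 0 la))].

Definition ballcols (n : nat) (B : seq (seq bool)) (r : nat) : seq nat :=
  [seq j <- iota 1 n | cell B r j].

(* Column word: columns left to right, in each column cells top to   *)
(* bottom; we keep the cells (row, col), the word is their rows.     *)
Definition cw_cells (n : nat) (B : seq (seq bool)) : seq (nat * nat) :=
  flatten [seq [seq (r, j) | r <- rev (iota 1 (size B)) & cell B r j]
          | j <- iota 1 n].

Definition cw (n : nat) (B : seq (seq bool)) : seq nat := map fst (cw_cells n B).

(* Bracketing Par_i(w).  We keep the list of (position, letter) of   *)
(* the letters i, i+1 of w; letter i+1 is "(", letter i is ")".      *)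
(* One matching step removes the first "(" immediately followed (in  *)
(* the list of not-yet-matched parentheses) by ")"; this is iterated *)
(* until no such pair remains.  What is left are the unmatched ones. *)
Fixpoint par_step (i : nat) (s : seq (nat * nat)) : option (seq (nat * nat)) :=
  match s with
  | x :: ((y :: t) as s') =>
      if (x.2 == i.+1) && (y.2 == i) then Some t
      else omap (cons x) (par_step i s')
  | _ => None
  end.

Fixpoint par_reduce (i fuel : nat) (s : seq (nat * nat)) : seq (nat * nat) :=
  match fuel with
  | 0 => s
  | f.+1 => match par_step i s with
            | Some s' => par_reduce i f s'
            | None => s
            end
  end.

Definition unmatched_pos (i : nat) (w : seq nat) : seq nat :=
  let s := [seq x <- zip (iota 0 (size w)) w | (x.2 == i) || (x.2 == i.+1)] in
  map fst (par_reduce i (size s) s).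

Definition unmatched_above_cols (n : nat) (i : nat) (B : seq (seq bool)) : seq nat :=
  let cells := cw_cells n B in
  let w := map fst cells in
  [seq (nth (0, 0) cells p).2 | p <- unmatched_pos i w & nth 0 w p == i.+1].

Definition estar (n : nat) (i : nat) (B : seq (seq bool)) : seq (seq bool) :=
  let U := unmatched_above_cols n i B in
  [seq [seq (if (r == i) && (j \in U) then true
             else if (r == i.+1) && (j \in U) then false
             else cell B r j) | j <- iota 1 n]
  | r <- iota 1 (size B)].

Definition estar_int (n a b : nat) (B : seq (seq bool)) : seq (seq bool) :=
  foldr (estar n) B (iota a (b.+1 - a)).

Fixpoint collapseD (n : nat) (k : nat) (B : seq (seq bool)) : seq (seq bool) :=
  match k with
  | 0 => B
  | k'.+1 => estar_int n 1 k (collapseD n k' B)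
  end.

Definition rho_N (n : nat) (B : seq (seq bool)) : seq (seq bool) :=
  collapseD n (size B).-1 B.

(* |N^(k)_r| : N^(k) = bottom k rows of D (k-1); N^(0) empty;        *)
(* the size is 0 if row r does not exist in N^(k) (r > k).           *)
Definition Nsize (n : nat) (B : seq (seq bool)) (k r : nat) : nat :=
  if (0 < r) && (r <= k) then count id (brow (collapseD n k.-1 B) r) else 0.

Definition rhoQ_row (n : nat) (B : seq (seq bool)) (r : nat) : seq nat :=
  flatten [seq nseq (Nsize n B i r - Nsize n B i.-1 r) i | i <- iota 1 (size B)].

Definition rho_Q (n : nat) (B : seq (seq bool)) : seq (seq nat) :=
  [seq rhoQ_row n B r | r <- iota 1 (size B)].

(* Tableaux: a filling is a list of rows, bottom row first.          *)
Definition rrw (T : seq (seq nat)) : seq nat := flatten (rev T).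

(* charge of a permutation t of [m] in one-line notation *)
Definition perm_charge (t : seq nat) : nat :=
  let m := size t in
  \sum_(1 <= i < m) (if index i t < index i.+1 t then m - i else 0).

Definition next_cyc (w : seq nat) (p m : nat) : option nat :=
  let after := [seq q <- iota p.+1 (size w - p.+1) | nth 0 w q == m] in
  let before := [seq q <- iota 0 p.+1 | nth 0 w q == m] in
  ohead (after ++ before).

Fixpoint chase (w : seq nat) (p m : nat) : seq nat :=
  match m with
  | 0 => [::]
  | m'.+1 => match next_cyc w p m with
             | Some q => q :: chase w q m'
             | None => chase w p m'
             end
  end.

Definition first_sel (w : seq nat) : seq nat :=
  let k := \max_(x <- w) x in
  let p := index k w in
  p :: chase w p k.-1.

Fixpoint charge_aux (fuel : nat) (w : seq nat) : nat :=
  match fuel with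
  | 0 => 0
  | f.+1 =>
      if w is [::] then 0 else
      let S := first_sel w in
      let sub := [seq nth 0 w q | q <- sort leq S] in
      let rest := [seq nth 0 w q | q <- iota 0 (size w) & q \notin S] in
      perm_charge sub + charge_aux f rest
  end.

Definition charge (w : seq nat) : nat := charge_aux (size w) w.

Definition charge_tab (T : seq (seq nat)) : nat := charge (rrw T).

(* One pairing: ball (j, l) of row r (column j, label l) is paired   *)
(* with the first still-available ball of row r-1 weakly right of j, *)
(* cyclically.  State: (paired balls of row r-1 with labels,         *)
(* available columns of row r-1 (increasing), maj so far).           *)
Definition fm_pair (r : nat) (st : seq (nat * nat) * seq nat * nat)
    (b : nat * nat) : seq (nat * nat) * seq nat * nat :=
  let: (assigned, avail, m) := st in
  let: (j, l) := b in
  let cands := [seq c <- avail | j <= c] in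
  let oc := if cands is c :: _ then Some c else ohead avail in
  match oc with
  | Some c => (rcons assigned (c, l), rem c avail,
               m + (if c < j then l - r + 1 else 0))
  | None => st
  end.

(* lab : the labelled balls (column, label) of row r (all balls of
   row r are labelled at this point).  Returns the maj contribution of
   the pairings between rows r and r-1, r-1 and r-2, ..., 2 and 1.    *)
Fixpoint fm_from (n : nat) (B : seq (seq bool)) (r : nat)
    (lab : seq (nat * nat)) : nat :=
  match r with
  | 0 => 0
  | r'.+1 =>
      if r' is 0 then 0 else
      (* decreasing label, left to right among equal labels *)
      let order := sort (fun a b => b.2 <= a.2) (sort (fun a b => a.1 <= b.1) lab) in
      let: (assigned, avail, m) :=
        foldl (fm_pair r) ([::], ballcols n B r', 0) order in
      let lab' := assigned ++ [seq (c, r') | c <- avail] in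
      m + fm_from n B r' lab'
  end.

Definition maj (n : nat) (B : seq (seq bool)) : nat :=
  let L := size B in
  fm_from n B L [seq (c, L) | c <- ballcols n B L].

(* Main.v *)
Require Import Defs.
From mathcomp Require Import all_boot zify.

Set Implicit Arguments.
Unset Strict Implicit.
Unset Printing Implicit Defensive.

(** Since [l - r + 1] is the number of thresholds [t] with [r <= t <= l], the
    major index is a sum over [t] of numbers of wrapping pairings among the
    balls of label at least [t].  For fixed [t] the labels disappear: start with
    all of row [t], let it park cyclically on row [t - 1], let the occupied
    places park on row [t - 2], and so on, counting the wraps.  The set of
    occupied places and the number of wraps do not depend on the order in which
    balls are processed, because a ball and its cyclic successor can always be
    removed first; removing a whole chain at a time shows that the charge of a
    word of partition content is given by the same count.  Hence [maj n M] is
    the charge of [cw n M].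

    This count is invariant under the exchange of adjacent letters that differ
    by at least 2 and under [a (a+1) a ~ (a+1) a a] and
    [(a+1) a (a+1) ~ (a+1) (a+1) a], hence under Knuth equivalence.  The
    collapsing operators also respect Knuth equivalence, so [rho_Q] depends only
    on the Knuth class of [cw n M]; that class contains the row word of a
    tableau [T], on which collapsing is explicit and returns [T]. *)

(** * Cyclic parking *)

(* Letters [i.+1] are balls looking for a place, letters [i] are places;
   [park] keeps the occupied places and all smaller letters. *)
Section Parking.
Variables (T : Type) (f : T -> nat) (i : nat).

Definition queue_upd c x :=
  if f x == i.+1 then c.+1 else if f x == i then c.-1 else c.

Definition queue := foldl queue_upd.

Fixpoint park c s :=
  if s is x :: s' then
    let u := park (queue_upd c x) s' in
    if (f x < i) || (f x == i) && (0 < c) then x :: u else u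
  else [::].

(* The [queue 0 s] sources left over at the end of [s] wrap around and are
   already waiting when [s] is scanned a second time. *)
Definition park_cyc s := park (queue 0 s) s.

Lemma queue_cat c s1 s2 : queue c (s1 ++ s2) = queue (queue c s1) s2.
Proof. exact: foldl_cat. Qed.

Lemma park_cat c s1 s2 : park c (s1 ++ s2) = park c s1 ++ park (queue c s1) s2.
Proof. by elim: s1 c => //= x s IH c; rewrite IH; case: ifP. Qed.

Definition target x := f x == i.
Definition source x := f x == i.+1.

Lemma queue_no_target c s : ~~ has target s -> queue c s = c + count source s.
Proof.
elim: s c => [|x s IH] c /=; first by rewrite addn0.
rewrite negb_or => /andP[/negbTE tx /IH->].
by rewrite /queue_upd -/(source x) -/(target x) tx; case: (source x); lia.
Qed.

Lemma park_no_target c c' s : ~~ has target s -> park c s = park c' s.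
Proof.
elim: s c c' => //= x s IH c c'; rewrite negb_or => /andP[/negbTE tx ts].
by rewrite -/(target x) tx !orbF (IH _ (queue_upd c' x)).
Qed.

(** An extra waiting ball is absorbed at the first target where the original queue is empty. If
    there is no such target it survives, and then every target has served a ball, so the balance of
    sources and targets is exact. *)
Lemma queue_succ c s :
  queue c.+1 s = queue c s \/
  [/\ queue c.+1 s = (queue c s).+1 & c + count source s = queue c s + count target s].
Proof.
rewrite /source /target; elim: s c => [|x s IH] c /=; first by right.
rewrite /queue_upd; case: (eqVneq (f x) i.+1) => [->|_].
  by rewrite gtn_eqF //=; case: (IH c.+1) => [->|[-> ?]]; [left|right; split=> //; lia].
case: (eqVneq (f x) i) => _ /=.
  case: c => [|c] /=; first by left.
  by case: (IH c) => [->|[-> ?]]; [left|right; split=> //; lia].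
by case: (IH c) => [->|[-> ?]]; [left|right; split=> //; lia].
Qed.

End Parking.

(** All letters [i.+1] descend together to level 1 and the wraps of every level are added; this is
    the count for the threshold [t = i.+1]. *)
Fixpoint wraps T (f : T -> nat) i s :=
  if i is j.+1 then queue f i 0 s + wraps f j (park_cyc f i s) else 0.

Section ParkingMap.
Variables (T : Type) (f : T -> nat).

Lemma queue_map i c s : queue id i c (map f s) = queue f i c s.
Proof. by elim: s c => //= x s IH c; rewrite IH. Qed.

Lemma park_map i c s : park id i c (map f s) = map f (park f i c s).
Proof. by elim: s c => //= x s IH c; rewrite IH; case: ifP. Qed.

Lemma wraps_map i s : wraps id i (map f s) = wraps f i s.
Proof.
elim: i s => //= i IH s.
by rewrite queue_map -IH /park_cyc queue_map park_map.
Qed.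

Lemma queue_filter i c (P : pred T) s : (forall x, i <= f x <= i.+1 -> P x) ->
  queue f i c (filter P s) = queue f i c s.
Proof.
move=> hP; elim: s c => //= x s IH c; case: ifP => [_|nP] /=; rewrite IH //.
congr (queue _ _ _ _); rewrite /queue_upd.
have : ~~ (i <= f x <= i.+1) by apply/negP => /hP; rewrite nP.
by case: eqP => [->|_]; [lia|case: eqP => [->|//]; lia].
Qed.

Lemma park_filter i c (P : pred T) s : (forall x, i <= f x <= i.+1 -> P x) ->
  park f i c (filter P s) = filter P (park f i c s).
Proof.
move=> hP; elim: s c => //= x s IH c.
case: ifP => [Px|nP] /=; first by case: ifP => /= _; rewrite ?Px IH.
have nfx : ~~ (i <= f x <= i.+1) by apply/negP => /hP; rewrite nP.
have -> : queue_upd f i c x = c.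
  rewrite /queue_upd; by case: eqP => [?|_]; [lia|case: eqP => [?|//]; lia].
by rewrite IH; case: ifP => //= _; rewrite nP.
Qed.

Lemma count_park_low i c (P : pred T) s : (forall x, P x -> f x < i) ->
  count P (park f i c s) = count P s.
Proof.
move=> hP; elim: s c => //= x s IH c.
case: ifP => /= [_|/negbT]; rewrite IH // negb_or.
by case: (boolP (P x)) => // /hP ->.
Qed.

Lemma wraps_high i s : all (fun x => f x <= i) s -> wraps f i s = 0.
Proof.
elim: i s => //= i IH s hs.
have E s0 : all (fun x => f x <= i.+1) s0 ->
    queue f i.+1 0 s0 = 0 /\ all (fun x => f x <= i) (park f i.+1 0 s0).
  elim: s0 => //= x s0 IHs /andP[fx /IHs[q0 a0]].
  have -> : queue_upd f i.+1 0 x = 0 by rewrite /queue_upd; case: eqP => [?|]; [lia|case: ifP].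
  by split=> //; rewrite andbF orbF; case: ifP => //= fxi; rewrite -ltnS fxi.
by have [q0 a0] := E _ hs; rewrite /park_cyc q0 IH.
Qed.

End ParkingMap.

(** * Removing a ball together with its cyclic successor *)

Section ParkingRemoval.
Variables (T : eqType) (f : T -> nat) (i : nat).

(* [b] records whether the first target weakly after [x] in cyclic order is
   found only after wrapping around the end of [s]. *)
Definition cyc_next (s : seq T) x y (b : bool) :=
  [/\ f x = i.+1, f y = i & exists p q r, if b then
      [/\ s = p ++ y :: q ++ x :: r, ~~ has (target f i) p & ~~ has (target f i) r]
    else s = p ++ x :: q ++ y :: r /\ ~~ has (target f i) q].

Lemma cyc_next_filter (P : pred T) s x y b : P x -> P y ->
  cyc_next s x y b -> cyc_next (filter P s) x y b.
Proof.
have hf s0 : ~~ has (target f i) s0 -> ~~ has (target f i) (filter P s0).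
  by apply: contra => /hasP[z]; rewrite mem_filter => /andP[_ zs] tz; apply/hasP; exists z.
move=> Px Py [fx fy [p [q [r H]]]]; split=> //.
exists (filter P p), (filter P q), (filter P r); case: b H.
  move=> [-> h1 h2]; split; [|exact: hf|exact: hf].
  by rewrite filter_cat /= Py filter_cat /= Px.
move=> [-> h]; split; last exact: hf.
by rewrite filter_cat /= Px filter_cat /= Py.
Qed.

(** Without a wrap, [x] only lengthens the queue on a stretch free of targets. With a wrap, [y]
    precedes all other targets and [x] follows them; the hypothesis on counts ensures that a waiting
    ball deprived of [y] still finds a place before the end. *)
Lemma park_cyc_remove s x y b : uniq s -> cyc_next s x y b ->
  count (source f i) s <= count (target f i) s ->
  [/\ queue f i 0 s = b + queue f i 0 [seq z <- s | z \notin [:: x; y]],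
      y \in park_cyc f i s &
      park_cyc f i [seq z <- s | z \notin [:: x; y]] = [seq z <- park_cyc f i s | z != y]].
Proof.
move=> us [fx fy [p [q [r H]]]] hc.
have ux c : queue_upd f i c x = c.+1 by rewrite /queue_upd fx eqxx.
have uy c : queue_upd f i c y = c.-1 by rewrite /queue_upd fy ltn_eqF // eqxx.
have kx c : ((f x < i) || (f x == i) && (0 < c)) = false.
  by rewrite fx; lia.
have ky c : ((f y < i) || (f y == i) && (0 < c)) = (0 < c).
  by rewrite fy eqxx ltnn.
have sx : source f i x by rewrite /source fx.
have tx : target f i x = false by rewrite /target fx; lia.
have sy : source f i y = false by rewrite /source fy; lia.
have ty : target f i y by rewrite /target fy.
have sub c s0 : {subset park f i c s0 <= s0}.
  elim: s0 c => //= z s0 IH c w; case: ifP => _; rewrite !inE.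
    by case/orP => [->//|/IH ->]; rewrite orbT.
  by move/IH ->; rewrite orbT.
have idf s0 : x \notin s0 -> y \notin s0 -> [seq z <- s0 | z \notin [:: x; y]] = s0.
  move=> hx hy; apply/all_filterP/allP => z zs; rewrite !inE negb_or.
  by apply/andP; split; [apply: contraNneq hx|apply: contraNneq hy] => <-.
have idy s0 c : y \notin s0 -> [seq z <- park f i c s0 | z != y] = park f i c s0.
  move=> hy; apply/all_filterP/allP => z /sub zs.
  by apply: contraNneq hy => <-.
case: b H => [[es np nr]|[es nq]].
  have : uniq (x :: y :: p ++ q ++ r).
    rewrite -(@perm_uniq _ s) // es; apply/permP => P; rewrite /= !count_cat /= count_cat /=; lia.
  rewrite /= !inE !mem_cat !negb_or => /and3P[/andP[xy /and3P[xp xq xr]] /and3P[yp yq yr] _].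
  have es' : [seq z <- s | z \notin [:: x; y]] = p ++ q ++ r.
    by rewrite es filter_cat /= !inE eqxx orbT /= filter_cat /= !inE eqxx /= !idf.
  rewrite /park_cyc es'.
  have qs c : queue f i c s = (queue f i (queue f i c p).-1 q).+1 + count (source f i) r.
    by rewrite es queue_cat /= uy queue_cat /= ux queue_no_target.
  have qs' c : queue f i c (p ++ q ++ r) = queue f i (queue f i c p) q + count (source f i) r.
    by rewrite !queue_cat (queue_no_target _ nr).
  have Q : queue f i 0 s = 1 + queue f i 0 (p ++ q ++ r).
    rewrite qs qs' (queue_no_target _ np) add0n; case E: (count (source f i) p) => [|k] //=.
    (* If the extra ball survived [q], all targets of [q] would be used up, so sources would
       outnumber targets in [s], against [hc]. *)
    case: (queue_succ f i k q) => [->|[-> H]]; first by lia.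
    move: hc; rewrite es !count_cat /= !count_cat /= sx sy ty tx E.
    rewrite has_count in np; rewrite has_count in nr; lia.
  split; first by [].
    rewrite Q es park_cat /= ky mem_cat (queue_no_target _ np).
    by rewrite inE eqxx orbT.
  rewrite Q es !park_cat /= ky !(queue_no_target _ np) /= !park_cat uy /= kx ux.
  rewrite filter_cat /= eqxx /= filter_cat !idy //.
  congr (_ ++ (_ ++ _)); exact: park_no_target.
have : uniq (x :: y :: p ++ q ++ r).
  rewrite -(@perm_uniq _ s) // es; apply/permP => P; rewrite /= !count_cat /= count_cat /=; lia.
rewrite /= !inE !mem_cat !negb_or => /and3P[/andP[xy /and3P[xp xq xr]] /and3P[yp yq yr] _].
have es' : [seq z <- s | z \notin [:: x; y]] = p ++ q ++ r.
  by rewrite es filter_cat /= !inE eqxx /= filter_cat /= !inE eqxx orbT /= !idf.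
have Q c : queue f i c s = queue f i c (p ++ q ++ r).
  rewrite es !queue_cat /= ux queue_cat /= uy !(queue_no_target _ nq); congr (queue _ _ _ _); lia.
have E c : park f i c s = park f i c p ++ park f i (queue f i c p) q
     ++ y :: park f i (queue f i (queue f i c p) q) r.
  rewrite es park_cat /= kx ux park_cat /= ky uy !(queue_no_target _ nq) addSn /=.
  by congr (_ ++ (_ ++ _)); exact: park_no_target.
split; first by rewrite es' Q.
  by rewrite /park_cyc E !mem_cat inE eqxx !orbT.
rewrite /park_cyc es' -Q E !filter_cat /= eqxx /= !idy //.
by rewrite !park_cat.
Qed.

End ParkingRemoval.

Lemma park_subseq (T : eqType) (f : T -> nat) i c s : subseq (park f i c s) s.
Proof.
elim: s c => //= x s IH c; case: ifP => _; first by rewrite /= eqxx.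
exact: (subseq_trans (IH _) (subseq_cons _ _)).
Qed.

(** The chain loses one link per level: once the top link is removed, parking leaves its lower end
    as a ball of the next level and does not touch smaller letters, so the other links stay cyclic
    successors. [P] is constrained only up to [i.+1] because the chain may extend higher. *)
Lemma wraps_remove_chain (T : eqType) (f : T -> nat) i (s : seq T) (X : nat -> T)
    (b : nat -> bool) (P : pred T) :
  uniq s -> all (fun x => 0 < f x) s ->
  (forall j, 0 < j <= i -> cyc_next f j s (X j.+1) (X j) (b j)) ->
  (forall j, 0 < j <= i -> count (source f j) s <= count (target f j) s) ->
  {in s, forall x, f x <= i.+1 -> P x = (x != X (f x))} ->
  wraps f i s = \sum_(1 <= j < i.+1) b j + wraps f i (filter P s).
Proof.
elim: i s P => [|i IH] s P us pos hX hc hP; first by rewrite big_geq.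
have hXi := hX i.+1 (ltnSn _).
have [q0 yin pk] := park_cyc_remove us hXi (hc i.+1 (ltnSn _)).
have [fx fy _] := hXi.
set x := X i.+2 in q0 pk fx hXi *; set y := X i.+1 in q0 pk fy hXi yin *.
set s' := [seq z <- s | z \notin [:: x; y]] in q0 pk *.
(* [P] is relaxed on the two levels being parked, where deleting [x] and [y] has the same effect;
   [R] can then be moved across the parking. *)
pose R z := (i.+1 <= f z <= i.+2) || P z.
have RP z : i.+1 <= f z <= i.+2 -> R z by rewrite /R => ->.
have Es : filter P s = filter R s'.
  rewrite -filter_predI; apply: eq_in_filter => z zs /=; rewrite /R !inE negb_or.
  case: (boolP (i.+1 <= f z <= i.+2)) => [/andP[z1 z2]|nz] /=.
    rewrite hP //; have [fz|fz] : f z = i.+1 \/ f z = i.+2 by lia.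
      have -> : z != x by apply: contra_eqN fz => /eqP->; lia.
      by rewrite fz.
    rewrite fz -/x andbC.
    by have -> : z != y by apply: contra_eqN fz => /eqP->; lia.
  have -> : z != x by apply/eqP => zx; move: nz; rewrite zx fx; lia.
  have -> : z != y by apply/eqP => zy; move: nz; rewrite zy fy; lia.
  exact: esym (andbT _).
rewrite /= Es queue_filter // q0 big_nat_recr //= /park_cyc queue_filter // park_filter //.
rewrite -/(park_cyc f i.+1 s') pk -filter_predI -/(park_cyc f i.+1 s).
set s1 := park_cyc f i.+1 s in yin *.
have ss1 : subseq s1 s by exact: park_subseq.
have sub1 : {subset s1 <= s} by exact: mem_subseq.
have low z : f z < i.+1 -> (z \in s1) = (z \in s).
  move=> fz; rewrite -!has_pred1 !has_count count_park_low // => _ /eqP->; lia.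
have Xs j : 0 < j <= i.+1 -> X j \in s.
  move=> hj; have [_ _ [p [q [r]]]] := hX j hj; case: (b j).
    by move=> [-> _ _]; rewrite mem_cat inE eqxx orbT.
  by move=> [-> _]; rewrite mem_cat inE mem_cat inE eqxx !orbT.
have Xf j : 0 < j <= i.+1 -> f (X j) = j by move=> /hX[].
have Xs1 j : 0 < j <= i.+1 -> X j \in s1.
  move=> hj; have [->//|nj] := eqVneq j i.+1.
  by rewrite low ?Xf ?Xs //; lia.
have es1 : s1 = filter (mem s1) s by apply/subseq_uniqP.
rewrite (IH s1 (fun z => R z && (z != y))) //; first 1 last.
- exact: subseq_uniq us.
- by apply/allP => z /sub1; move/allP: pos; apply.
- by move=> j hj; rewrite es1; apply: cyc_next_filter; rewrite ?inE ?Xs1 //=; [lia|lia|apply: hX; lia].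
- move=> j hj; rewrite (@count_park_low _ _ _ _ (target f j)); last by move=> z /eqP->; lia.
  apply: leq_trans (hc j _); last by lia.
  exact: leq_count_subseq.
- move=> z zs1 fz; rewrite /=; case: (ltnP i (f z)) => fz'.
    have e : f z = i.+1 by lia.
    by rewrite RP ?e //; lia.
  have -> : z != y by apply/eqP => zy; move: fz'; rewrite zy fy; lia.
  have -> : R z = P z by rewrite /R ltnNge fz'.
  by rewrite andbT; apply: hP; [exact: sub1|exact: ltnW].
by rewrite -/s1 !addnA; congr (_ + _); lia.
Qed.

(** * Charge *)

(** Translates cyclic succession into an order; it serves both for positions in a word and for cells
    in reading order. *)
Lemma cyc_next_sorted (T : eqType) (f : T -> nat) i (lt : rel T) s x y b :
  irreflexive lt -> transitive lt -> sorted lt s -> x \in s -> y \in s ->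
  f x = i.+1 -> f y = i -> (if b then lt y x else lt x y) ->
  {in s, forall z, f z = i -> if b then ~~ lt z y && ~~ lt x z else ~~ (lt x z && lt z y)} ->
  cyc_next f i s x y b.
Proof.
move=> irr tr ss xs ys fx fy lxy hz; split=> //.
have split2 u v : u \in s -> v \in s -> lt u v -> exists p q r,
    s = p ++ u :: q ++ v :: r.
  move=> us vs uv; case/splitPr: us ss vs => p r; rewrite sorted_pairwise //.
  rewrite pairwise_cat mem_cat inE /= => /and3P[/allrelP pr _ _] /or3P[vp|/eqP e|vr].
  - have := tr _ _ _ uv (pr v u vp (mem_head _ _)); by rewrite irr.
  - by move: uv; rewrite e irr.
  - by case/splitPr: vr => q r'; exists p, q, r'.
case: b lxy hz => lxy hz.
  have [p [q [r es]]] := split2 _ _ ys xs lxy; exists p, q, r.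
  move: ss; rewrite sorted_pairwise // es pairwise_cat /= pairwise_cat /=.
  move=> /and3P[/allrelP h1 _ /andP[_ /and3P[_ _ /andP[/allP h2 _]]]].
  split=> //; apply/hasPn => z zs; apply/eqP => fz.
    have /hz/(_ fz)/andP[] : z \in s by rewrite es mem_cat zs.
    by rewrite h1 // mem_head.
  have /hz/(_ fz)/andP[_] : z \in s by rewrite es mem_cat inE mem_cat inE zs !orbT.
  by rewrite h2.
have [p [q [r es]]] := split2 _ _ xs ys lxy; exists p, q, r; split=> //.
move: ss; rewrite sorted_pairwise // es pairwise_cat /= pairwise_cat /=.
move=> /and3P[_ _ /andP[/allP h1 /and3P[/allrelP h2 _ _]]].
apply/hasPn => z zs; apply/eqP => fz.
have /hz/(_ fz) : z \in s by rewrite es mem_cat inE mem_cat zs !orbT.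
by rewrite h1 ?mem_cat ?zs // h2 // mem_head.
Qed.

Definition partition_content (w : seq nat) :=
  all (fun x => 0 < x) w /\ forall j, 0 < j -> count_mem j.+1 w <= count_mem j w.

Lemma ohead_filter_sorted (P : pred nat) s q : sorted ltn s -> ohead (filter P s) = Some q ->
  [/\ q \in s, P q & {in s, forall z, P z -> q <= z}].
Proof.
move=> ss; have := sorted_filter ltn_trans P ss; case E: (filter P s) => [|a u] //= pa [<-].
have : a \in filter P s by rewrite E mem_head.
rewrite mem_filter => /andP[Pa as_]; split=> // z zs Pz.
have : z \in filter P s by rewrite mem_filter Pz.
rewrite E inE => /orP[/eqP->//|zu].
by move: pa; rewrite (path_sortedE ltn_trans) => /andP[/allP /(_ z zu) /ltnW].
Qed.

Lemma next_cycP w p m : p < size w -> nth 0 w p = m.+1 -> m \in w ->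
  exists q, [/\ next_cyc w p m = Some q, q < size w, nth 0 w q = m &
    cyc_next (nth 0 w) m (iota 0 (size w)) p q (q < p)].
Proof.
move=> pw fp mw; rewrite /next_cyc.
have ini z : (z \in iota 0 (size w)) = (z < size w) by rewrite mem_iota.
case E: (filter _ (iota p.+1 _)) => [|q u]; first rewrite cat0s.
  have na z : p < z < size w -> nth 0 w z != m.
    move=> hz; apply/negP => hm; suff : z \in [::] by [].
    by rewrite -E mem_filter hm mem_iota; lia.
  case E2: (ohead _) => [q|].
    have [] := ohead_filter_sorted (iota_ltn_sorted _ _) E2.
    rewrite mem_iota add0n => /andP[_ qp] /eqP fq qmin; exists q.
    (* The second half of the search includes [p] itself, but [p] carries [m.+1]. *)
    have qp' : q < p by have [e|] := eqVneq q p; [move: fp; rewrite -e fq; lia|lia].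
    split=> //; first by lia.
    apply: (cyc_next_sorted ltnn ltn_trans (iota_ltn_sorted _ _)); rewrite ?ini //; first by lia.
      by rewrite qp'.
    rewrite qp' => z; rewrite ini => zw fz; rewrite -leqNgt -leqNgt; apply/andP; split.
      case: (leqP z p) => zp; last by lia.
      by apply: qmin; rewrite ?fz ?mem_iota //; lia.
    rewrite leqNgt; apply/negP => pz; have := na z; rewrite fz eqxx pz zw => /(_ isT); done.
  exfalso; have [z zw fz] : exists2 z, z < size w & nth 0 w z = m.
    by exists (index m w); rewrite ?index_mem ?nth_index.
  have zp : z <= p by rewrite leqNgt; apply/negP => pz; have := na z; rewrite fz eqxx pz zw => /(_ isT).
  have : z \in [seq q <- iota 0 p.+1 | nth 0 w q == m] by rewrite mem_filter fz eqxx mem_iota; lia.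
  move: E2; case: (filter _ _) => //.
have [] := @ohead_filter_sorted _ _ q (iota_ltn_sorted p.+1 (size w - p.+1)) (congr1 ohead E).
rewrite mem_iota => hq /eqP fq qmin; exists q.
have pq : p < q by lia.
have nqp : (q < p) = false by lia.
split=> //; first by lia.
rewrite nqp; apply: (cyc_next_sorted ltnn ltn_trans (iota_ltn_sorted _ _)); rewrite ?ini //; first by lia.
move=> z; rewrite ini => zw fz; apply/negP => /andP[pz zq].
have := qmin z; rewrite mem_iota fz eqxx => h; have := h _ isT; lia.
Qed.

(** The chase lists positions by decreasing letter; [X] reindexes them by letter, the form needed to
    remove a chain. *)
Lemma chaseP w p m : p < size w -> nth 0 w p = m.+1 -> (forall j, 0 < j <= m -> j \in w) ->
  [/\ size (chase w p m) = m,
    forall j, j <= m -> nth 0 (p :: chase w p m) j < size w,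
    forall j, j <= m -> nth 0 w (nth 0 (p :: chase w p m) j) = m.+1 - j &
    forall j, 0 < j <= m -> let X k := nth 0 (p :: chase w p m) (m.+1 - k) in
      cyc_next (nth 0 w) j (iota 0 (size w)) (X j.+1) (X j) (X j < X j.+1)].
Proof.
elim: m p => [|m IH] p pw fp hm /=.
  by split=> //; [case|case|move=> j; lia].
have [q [-> qw fq cn]] := next_cycP pw fp (hm m.+1 (ltnSn _)).
have hm' j : 0 < j <= m -> j \in w by move=> hj; apply: hm; lia.
have [h1 h2 h3 h4] := IH q qw fq hm'.
split.
- by rewrite /= h1.
- by case=> //= j /h2.
- by case=> [|j] //= /h3.
move=> j hj; case: (ltnP m j) => jm.
  have -> : j = m.+1 by lia.
  by rewrite subnn subSnn.
have -> : m.+2 - j.+1 = (m.+1 - j.+1).+1 by lia.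
have -> : m.+2 - j = (m.+1 - j).+1 by lia.
by apply: h4; lia.
Qed.

Lemma ltn_index_sorted (s : seq nat) x y : sorted ltn s -> x \in s -> y \in s ->
  (index x s < index y s) = (x < y).
Proof.
move=> ss xs ys; have h := sorted_ltn_index ltn_trans ss.
case: (ltngtP (index x s) (index y s)) => [/h->//|/h yx|e].
  by have := yx ys xs; lia.
by rewrite -(nth_index 0 xs) e nth_index // ltnn.
Qed.

Lemma index_map_in (T U : eqType) (g : T -> U) (s : seq T) x : uniq s ->
  {in s &, injective g} -> x \in s -> index (g x) (map g s) = index x s.
Proof.
move=> us ing xs; rewrite -{2}(nth_index_map x ing xs) index_uniq //.
by rewrite -(size_map g) index_mem map_f.
Qed.

(** Each [b j] is counted once for every [i] with [j <= i < k]. This turns the weights [k - j] of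
    charge into a sum over levels. *)
Lemma sum_partial_sums k (b : nat -> nat) :
  \sum_(0 <= i < k) \sum_(1 <= j < i.+1) b j = \sum_(1 <= j < k) (k - j) * b j.
Proof.
elim: k => [|k IH]; first by rewrite !big_geq.
rewrite big_nat_recr //= IH; case: k {IH} => [|k]; first by rewrite !big_geq.
rewrite [RHS]big_nat_recr //= subSnn mul1n [X in _ + X]big_nat_recr //= addnA; congr (_ + _).
rewrite -big_split; apply: eq_big_nat => j hj /=; lia.
Qed.

Lemma partition_content_mem w k j : partition_content w -> k \in w -> 0 < j <= k -> j \in w.
Proof.
move=> [_ hc] kw /andP[j0 jk]; rewrite -has_pred1 has_count.
move: kw; have {1}-> : k = j + (k - j) by lia.
rewrite -has_pred1 has_count; elim: (k - j) => [|d IH]; first by rewrite addn0.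
by rewrite addnS => h; apply: IH; apply: leq_trans h (hc _ _); lia.
Qed.

Section FirstChain.
Variables (w : seq nat) (w0 : w != [::]) (pc : partition_content w).
Let k := \max_(x <- w) x.
Let S := first_sel w.
Let X j := nth 0 S (k - j).
Let f := nth 0 w.

Let kw : k \in w.
Proof.
rewrite /k; case: w w0 => // a u _; elim: u a => [|b u IH] a.
  by rewrite big_seq1 mem_head.
rewrite big_cons /maxn; case: ifP => _; last exact: mem_head.
by rewrite inE IH orbT.
Qed.

Let k0 : 0 < k.
Proof. by case: pc => /allP /(_ _ kw). Qed.

Let w_le x : x \in w -> x <= k.
Proof. by move=> xw; rewrite /k; apply: (leq_bigmax_seq (F := id)). Qed.

Let chain : [/\ size S = k,
    forall j, j < k -> nth 0 S j < size w,
    forall j, j < k -> f (nth 0 S j) = k - j &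
    forall j, 0 < j < k -> cyc_next f j (iota 0 (size w)) (X j.+1) (X j) (X j < X j.+1)].
Proof.
have e : k = k.-1.+1 by lia.
have pw : index k w < size w by rewrite index_mem.
have fp : f (index k w) = k.-1.+1 by rewrite /f nth_index.
have hm j : 0 < j <= k.-1 -> j \in w.
  by move=> hj; apply: (partition_content_mem pc kw); lia.
have [h1 h2 h3 h4] := chaseP pw fp hm.
split.
- by rewrite /S /first_sel /= -/k h1 -e.
- by move=> j jk; apply: h2; lia.
- move=> j jk; rewrite [in RHS]e; apply: h3; lia.
- by move=> j jk; rewrite /X e; apply: h4; lia.
Qed.

Let fX j : 0 < j <= k -> f (X j) = j.
Proof. by move=> hj; have [_ _ h _] := chain; rewrite h; lia. Qed.

Let XS j : 0 < j <= k -> X j \in S.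
Proof. by move=> hj; have [h _ _ _] := chain; rewrite mem_nth ?h; lia. Qed.

Let inS z : z \in S -> [/\ z < size w, 0 < f z <= k & z = X (f z)].
Proof.
have [h1 h2 h3 _] := chain.
case/(nthP 0) => j; rewrite h1 => jk <-; rewrite h2 // h3 //; split=> //; first by lia.
by rewrite /X; congr (nth _ _ _); lia.
Qed.

Let injS : {in S &, injective f}.
Proof. by move=> x y /inS[_ _ ex] /inS[_ _ ey] e; rewrite ex e -ey. Qed.

Let uniqS : uniq S.
Proof.
have [h1 _ h3 _] := chain; apply/(uniqP 0) => a b; rewrite !inE h1 => ak bk e.
have := h3 a ak; rewrite e h3 //; lia.
Qed.

Let sub := [seq nth 0 w q | q <- sort leq S].
Let rest := [seq nth 0 w q | q <- iota 0 (size w) & q \notin S].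

(** The letter [j] stands to the left of [j.+1] exactly when the chase from [j.+1] to [j] wraps. *)
Lemma perm_charge_first_chain :
  perm_charge sub = \sum_(1 <= j < k) (k - j) * (X j < X j.+1).
Proof.
have [h1 _ _ _] := chain.
rewrite /perm_charge /sub size_map size_sort h1; apply: eq_big_nat => j hj.
have sT : sorted ltn (sort leq S).
  by rewrite ltn_sorted_uniq_leq sort_uniq uniqS sort_sorted //; exact: leq_total.
have iX m : 0 < m <= k -> index m [seq nth 0 w q | q <- sort leq S] = index (X m) (sort leq S).
  move=> hm; rewrite -{1}(fX hm) index_map_in ?sort_uniq ?mem_sort ?XS //.
  by move=> x y; rewrite !mem_sort; apply: injS.
rewrite !iX ?ltn_index_sorted ?mem_sort ?XS //; try lia.
by case: ifP => _; rewrite ?muln1 ?muln0.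
Qed.

Lemma wraps_first_chain i : i < k ->
  wraps id i w = \sum_(1 <= j < i.+1) (X j < X j.+1) + wraps id i rest.
Proof.
move=> ik; have [_ _ _ h4] := chain; have [pos hc] := pc.
have ew : w = map f (iota 0 (size w)) by rewrite /f -/(mkseq _ _) mkseq_nth.
have fw z : z \in iota 0 (size w) -> f z \in w by rewrite mem_iota => zw; rewrite mem_nth.
rewrite [in LHS]ew /rest !wraps_map.
apply: (@wraps_remove_chain _ _ _ _ X (fun j => X j < X j.+1)).
- exact: iota_uniq.
- by apply/allP => z /fw; move/allP: pos; apply.
- by move=> j hj; apply: h4; lia.
- move=> j hj; have /hc : 0 < j by lia.
  by rewrite [in X in X -> _]ew !count_map.
- move=> z zs fz; congr negb; apply/idP/eqP => [/inS[]//|->].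
  by apply: XS; rewrite (leq_trans fz) // andbT; move/allP: pos; apply; apply: fw.
Qed.

Lemma count_rest j : count_mem j rest = count_mem j w - (0 < j <= k).
Proof.
have ew : w = map f (iota 0 (size w)) by rewrite /f -/(mkseq _ _) mkseq_nth.
have h : count_mem j (map f S) + count_mem j rest = count_mem j w.
  rewrite [in RHS]ew /rest !count_map count_filter.
  have /permP -> : perm_eq S [seq z <- iota 0 (size w) | z \in S].
    apply: uniq_perm => //; first by rewrite filter_uniq ?iota_uniq.
    move=> z; rewrite mem_filter mem_iota /= add0n.
    by case zS : (z \in S) => //=; have [-> ] := inS zS.
  rewrite count_filter -count_predUI -[RHS]addn0; congr (_ + _).
    apply: eq_count => z /=; case: (z \in S); case: (_ == _) => //.
  apply/eqP; rewrite eqn0Ngt -has_count; apply/hasPn => z _ /=.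
  by case: (z \in S); rewrite ?andbF.
rewrite -h; suff -> : count_mem j (map f S) = (0 < j <= k) by lia.
rewrite count_uniq_mem ?map_inj_in_uniq //; congr nat_of_bool.
apply/mapP/idP => [[z /inS[_ ? _] ->]//|hj].
by exists (X j); rewrite ?XS ?fX.
Qed.

Lemma partition_content_rest : partition_content rest.
Proof.
have [pos hc] := pc; split.
  apply/allP => z /mapP[q]; rewrite mem_filter mem_iota => /andP[_ qw] ->.
  by move/allP: pos; apply; rewrite mem_nth.
move=> j j0; rewrite !count_rest; have := hc j j0.
have h z : k < z -> count_mem z w = 0.
  by move=> kz; apply/count_memPn; apply/negP => /w_le; lia.
have [jk|jk] := ltnP j k; first by lia.
by rewrite h; lia.
Qed.

Lemma size_rest : size rest < size w.
Proof.
rewrite /rest size_map size_filter -[X in _ < X](size_iota 0) ltn_neqAle count_size andbT.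
rewrite -all_count; apply/allPn; exists (X k); last by rewrite negbK XS // k0 leqnn.
by rewrite mem_iota /=; have [] := inS (XS (j := k) _); rewrite ?k0 ?leqnn.
Qed.

Lemma rest_sub : {subset rest <= w}.
Proof.
by move=> z /mapP[q]; rewrite mem_filter mem_iota => /andP[_ qw] ->; rewrite mem_nth.
Qed.

(** A wrap from [j.+1] to [j] in the first chain is seen at the levels from [j] to [k - 1], hence
    [k - j] times, as in charge. Levels from [k] on have no ball, in [w] or in [rest]. *)
Lemma charge_step N : all (fun x => x <= N) w ->
  \sum_(0 <= i < N) wraps id i w = perm_charge sub + \sum_(0 <= i < N) wraps id i rest.
Proof.
move=> /allP wN; have kN := wN _ kw.
rewrite perm_charge_first_chain -sum_partial_sums.
have split_k F : \sum_(0 <= i < N) F i = \sum_(0 <= i < k) F i + \sum_(k <= i < N) F i.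
  by rewrite -big_cat_nat.
rewrite !split_k addnA -big_split /=; congr (_ + _).
  by apply: eq_big_nat => i /andP[_ /wraps_first_chain ->].
apply: eq_big_nat => i /andP[ki _]; rewrite !wraps_high //.
  by apply/allP => z /rest_sub/w_le /leq_trans; apply.
by apply/allP => z /w_le /leq_trans; apply.
Qed.

End FirstChain.

(** Charge subwords are removed one after another; the bound [N] stays fixed while the largest
    letter may drop. *)
Lemma charge_wraps N w : partition_content w -> all (fun x => x <= N) w ->
  charge w = \sum_(0 <= i < N) wraps id i w.
Proof.
rewrite /charge; have : size w <= size w by [].
move: {2 3}(size w) => fuel; elim: fuel w => [|fuel IH] w.
  rewrite leqn0 size_eq0 => /eqP-> _ _; rewrite big1 // => i _.
  by rewrite wraps_high.
move=> hw pc wN; rewrite /=; have [->|w0] := eqVneq w [::].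
  by rewrite big1 // => i _; rewrite wraps_high.
rewrite (charge_step w0 pc wN) -IH //.
- by case: (w) w0.
- by have := size_rest w0 pc; lia.
- exact: partition_content_rest.
- by apply/allP => z /rest_sub; move/allP: wN; apply.
Qed.

(** * Knuth equivalence *)

Inductive word_cong (R : seq nat -> seq nat -> Prop) : seq nat -> seq nat -> Prop :=
| WordCongRefl u : word_cong R u u
| WordCongSym u v : word_cong R u v -> word_cong R v u
| WordCongTrans v u w : word_cong R u v -> word_cong R v w -> word_cong R u w
| WordCongStep p s a b : R a b -> word_cong R (p ++ a ++ s) (p ++ b ++ s).

Section WordCong.
Variable R : seq nat -> seq nat -> Prop.

Lemma word_cong_base a b : R a b -> word_cong R a b.
Proof. by move/(WordCongStep [::] [::]); rewrite !cats0. Qed.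

Lemma word_cong_context p s u v : word_cong R u v -> word_cong R (p ++ u ++ s) (p ++ v ++ s).
Proof.
elim=> {u v} [u|u v _ IH|v u w _ IH1 _ IH2|p' s' a b ab].
- exact: WordCongRefl.
- exact: WordCongSym.
- exact: WordCongTrans IH1 IH2.
- by rewrite -!catA !(catA p); apply: WordCongStep.
Qed.

Lemma word_cong_cat u u' v v' :
  word_cong R u u' -> word_cong R v v' -> word_cong R (u ++ v) (u' ++ v').
Proof.
move=> uu vv; apply: (WordCongTrans (v := u' ++ v)).
  exact: (word_cong_context [::] v uu).
by move: (word_cong_context u' [::] vv); rewrite !cats0.
Qed.

End WordCong.

Inductive knuth_rel : seq nat -> seq nat -> Prop :=
| KnuthLeft x y z : x <= y < z -> knuth_rel [:: x; z; y] [:: z; x; y]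
| KnuthRight x y z : x < y <= z -> knuth_rel [:: y; x; z] [:: y; z; x].

(* Unlike [knuth_rel], this family is stable under the deletion of letters
   performed by [park], and it still contains the Knuth relations. *)
Inductive local_rel : seq nat -> seq nat -> Prop :=
| LocalComm a b : a.+1 < b -> local_rel [:: a; b] [:: b; a]
| LocalLeft a : local_rel [:: a; a.+1; a] [:: a.+1; a; a]
| LocalRight a : local_rel [:: a.+1; a; a.+1] [:: a.+1; a.+1; a].

Notation knuth := (word_cong knuth_rel).
Notation local := (word_cong local_rel).

(** The exchanged letters [x < z] either differ by at least 2 and commute, or satisfy [z = x.+1],
    and then the inequalities force [y] to equal one of them. *)
Lemma knuth_local u v : knuth u v -> local u v.
Proof.
elim=> {u v} [u|u v _ IH|v u w _ IH1 _ IH2|p s a b ab].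
- exact: WordCongRefl.
- exact: WordCongSym.
- exact: WordCongTrans IH1 IH2.
apply: word_cong_context; case: ab => x y z h.
  case: (ltnP x.+1 z) => xz.
    exact: (WordCongStep [::] [:: y] (LocalComm xz)).
  have [-> ->] : x = y /\ z = y.+1 by lia.
  exact/word_cong_base/LocalLeft.
case: (ltnP x.+1 z) => xz.
  exact: (WordCongStep [:: y] [::] (LocalComm xz)).
have [-> ->] : y = x.+1 /\ z = x.+1 by lia.
exact/word_cong_base/LocalRight.
Qed.

Lemma local_park i u v : local u v -> forall c,
  queue id i c u = queue id i c v /\ local (park id i c u) (park id i c v).
Proof.
elim=> {u v} [u|u v _ IH|v u w _ IH1 _ IH2|p s a b ab] c.
- by split=> //; exact: WordCongRefl.
- by have [-> h] := IH c; split=> //; exact: WordCongSym.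
- have [-> h1] := IH1 c; have [-> h2] := IH2 c; split=> //.
  exact: WordCongTrans h1 h2.
suff {c} H c : queue id i c a = queue id i c b /\ local (park id i c a) (park id i c b).
  rewrite !queue_cat !park_cat; have [-> h] := H (queue id i c p); split=> //.
  exact: word_cong_context.
case: ab => [x y xy|x|x]; rewrite /= /queue_upd /=.
- have hl : x.+1 < y -> local [:: x; y] [:: y; x].
    by move=> h; apply: word_cong_base; apply: LocalComm.
  have := hl xy; have rr := WordCongRefl local_rel.
  by case: c => [|c] h; split; repeat case: eqP => ?; rewrite /=;
    repeat case: ltnP => ? //=; try lia; apply: rr.
- have h : local [:: x; x.+1; x] [:: x.+1; x; x] by apply: word_cong_base; apply: LocalLeft.
  have rr := WordCongRefl local_rel.
  by case: c => [|[|c]]; split; repeat case: eqP => ?; rewrite /=;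
    repeat case: ltnP => ? //=; try lia; apply: rr.
- have h : local [:: x.+1; x; x.+1] [:: x.+1; x.+1; x] by apply: word_cong_base; apply: LocalRight.
  have rr := WordCongRefl local_rel.
  by case: c => [|[|c]]; split; repeat case: eqP => ?; rewrite /=;
    repeat case: ltnP => ? //=; try lia; apply: rr.
Qed.

Lemma local_wraps i u v : local u v -> wraps id i u = wraps id i v.
Proof.
elim: i u v => //= i IH u v uv; have [q0 _] := local_park i.+1 uv 0.
rewrite /park_cyc q0; congr (_ + _); apply: IH.
by have [_] := local_park i.+1 uv (queue id i.+1 0 v).
Qed.

Lemma knuth_perm u v : knuth u v -> perm_eq u v.
Proof.
elim=> {u v} [u|u v _ IH|v u w _ IH1 _ IH2|p s a b ab] //.
- by rewrite perm_sym.
- exact: perm_trans IH1 IH2.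
rewrite perm_cat2l perm_cat2r.
by case: ab => x y z _; apply/permP => P /=; lia.
Qed.

(** The bracketing read from right to left: the counter is the number of letters [i] not yet
    matched, and a letter [i.+1] met at 0 is unmatched. The start [c] represents the part of the
    word further right. *)
Definition rqueue i c (s : seq nat) :=
  foldr (fun x c => if x == i.+1 then c.-1 else if x == i then c.+1 else c) c s.

(** For [c = 0] this is the crystal raising operator applied as often as possible, and the effect of
    [estar] on column words. *)
Fixpoint lower i c (s : seq nat) :=
  if s is x :: s' then
    (if (x == i.+1) && (rqueue i c s' == 0) then i else x) :: lower i c s'
  else [::].

Lemma rqueue_cat i c s1 s2 : rqueue i c (s1 ++ s2) = rqueue i (rqueue i c s2) s1.
Proof. exact: foldr_cat. Qed.

Lemma lower_cat i c s1 s2 : lower i c (s1 ++ s2) = lower i (rqueue i c s2) s1 ++ lower i c s2.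
Proof. by elim: s1 => //= x s ->; rewrite rqueue_cat. Qed.

(** A case check on three letters with counter 0, 1 or larger. The type of relation may change: for
    [c = 0], the pair [[:: i.+1; i; i.+1]], [[:: i.+1; i.+1; i]] becomes [[:: i.+1; i; i]],
    [[:: i; i.+1; i]]. *)
Lemma knuth_lower i u v : knuth u v -> forall c,
  rqueue i c u = rqueue i c v /\ knuth (lower i c u) (lower i c v).
Proof.
elim=> {u v} [u|u v _ IH|v u w _ IH1 _ IH2|p s a b ab] c.
- by split=> //; exact: WordCongRefl.
- by have [-> h] := IH c; split=> //; exact: WordCongSym.
- have [-> h1] := IH1 c; have [-> h2] := IH2 c; split=> //.
  exact: WordCongTrans h1 h2.
suff {c} H c : rqueue i c a = rqueue i c b /\ knuth (lower i c a) (lower i c b).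
  rewrite !lower_cat !rqueue_cat; have [-> h] := H (rqueue i c s); split=> //.
  exact: word_cong_context.
have rr := WordCongRefl knuth_rel.
have k1 x y z : x <= y < z -> knuth [:: x; z; y] [:: z; x; y].
  by move=> h; apply: word_cong_base; apply: KnuthLeft.
have k2 x y z : x < y <= z -> knuth [:: y; x; z] [:: y; z; x].
  by move=> h; apply: word_cong_base; apply: KnuthRight.
case: ab => x y z h; rewrite /=;
  case: (eqVneq x i.+1) => ?; case: (eqVneq x i) => ?; try lia;
  case: (eqVneq y i.+1) => ?; case: (eqVneq y i) => ?; try lia;
  case: (eqVneq z i.+1) => ?; case: (eqVneq z i) => ?; try lia;
  case: c => [|[|c]]; rewrite /=; split=> //; subst;
  by [exact: rr | apply: k1; lia | apply: k2; lia
     | apply: WordCongSym; apply: k1; lia | apply: WordCongSym; apply: k2; lia].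
Qed.

(** * Row insertion *)

Fixpoint row_insert x (R : seq nat) : seq nat * option nat :=
  if R is y :: R' then
    if x < y then (x :: R', Some y)
    else let: (R1, o) := row_insert x R' in (y :: R1, o)
  else ([:: x], None).

(** The letter [x] crosses each [z] of [R] by [KnuthRight]; the witness is the letter in front of
    [z], which exceeds [x] because the row is sorted. *)
Lemma knuth_slide x y R : sorted leq (y :: R) -> x < y ->
  knuth (y :: R ++ [:: x]) (y :: x :: R).
Proof.
elim: R y => [|z R IH] y /= => [_ _|/andP[yz zR] xy]; first exact: WordCongRefl.
apply: (WordCongTrans (v := [:: y, z, x & R])).
  by apply: (@word_cong_cat _ [:: y] [:: y]); [exact: WordCongRefl|apply: IH => //; lia].
apply: WordCongSym; apply: (@WordCongStep _ [::] R [:: y; x; z] [:: y; z; x]).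
by apply: KnuthRight; rewrite xy.
Qed.

(** The inserted letter slides left to its place, then the bumped letter moves to the front by
    [KnuthLeft]. The last clause records that the bumped letter is the least one above [x]. *)
Lemma row_insertP x R : sorted leq R ->
  match row_insert x R with
  | (R1, None) => R1 = rcons R x /\ all (fun z => z <= x) R
  | (R1, Some y) => [/\ x < y, y \in R, knuth (R ++ [:: x]) (y :: R1) &
                       all (fun z => (z <= x) || (y <= z)) R]
  end /\ sorted leq (row_insert x R).1.
Proof.
elim: R => [|y R IH] //= yR; case: ltnP => [xy|yx] /=.
  split.
    split=> //; [exact: mem_head|exact: knuth_slide|].
    rewrite leqnn /=; apply/allP => z zR.
    by rewrite (allP (order_path_min leq_trans yR)) ?orbT.
  by case: (R) yR => //= z R' /andP[yz ->]; rewrite andbT; lia.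
have {IH} [] := IH (path_sorted yR); case E: (row_insert x R) => [R1 [b|]] /=.
  move=> [xb bR kn h] sR1; split.
    split=> //; first by rewrite inE bR orbT.
    apply: (WordCongTrans (v := [:: y, b & R1])).
      by apply: (@word_cong_cat _ [:: y] [:: y]) => //; exact: WordCongRefl.
    case: R E yR {bR kn h} => [//|r R] /= E /andP[yr _].
    (* The head [h] of the changed row is the witness that lets [b] pass [y]. *)
    have [h [t [-> yh hb]]] : exists h t, [/\ R1 = h :: t, y <= h & h < b].
      move: E; case: ltnP => [xr [<- _]|rx].
        by exists x, R.
      by case: row_insert => R2 o [<- _]; exists r, R2; split=> //; lia.
    apply: (@WordCongStep _ [::] t [:: y; b; h] [:: b; y; h]).
    by apply: KnuthLeft; rewrite yh.
  case: R E yR {bR kn h} => [//|r R] /= E /andP[yr _].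
  move: E sR1; case: ltnP => [xr [<- _] /= ->|rx]; first by rewrite yx.
  by case: row_insert => R2 o [<- _] /= ->; rewrite yr.
move=> [-> h] sR1; split; first by split=> //; rewrite yx.
rewrite rcons_path yR /=; case/lastP: (R) h yR => //= R' z; rewrite last_rcons all_rcons.
by case/andP.
Qed.

(* [count]-form of column strictness for two sorted rows. *)
Definition strictly_below (R U : seq nat) :=
  forall k, count (fun x => x <= k) U <= count (fun x => x < k) R.

(** Let [y] leave [R] and [z] leave [U], with [z] infinite if nothing is bumped. Only thresholds
    [y <= k < z] are delicate. No letter of [U] lies strictly between [y] and [z], so the bound at
    [y] applies at [k]; the missing unit comes from [x] if [k = y], and from [y], counted in [R], if
    [y < k]. *)
Lemma strictly_below_insert x R U : sorted leq R -> sorted leq U -> strictly_below R U ->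
  strictly_below (row_insert x R).1
    (if (row_insert x R).2 is Some y then (row_insert y U).1 else U).
Proof.
move=> sR sU RU k; have [+ _] := row_insertP x sR; case: (row_insert x R) => R1 [y|] /=.
  move=> [xy yR kn _]; have /permP cR := knuth_perm kn.
  have := cR (fun z => z < k); rewrite count_cat /= addn0 => {}cR.
  have yk : y < k -> count (fun z => z < y) R < count (fun z => z < k) R.
    move=> yk; have -> : count (fun z => z < k) R =
        count (fun z => z < y) R + count (fun z => y <= z < k) R.
      by elim: (R) => //= z R' ->; lia.
    suff : 0 < count (fun z => y <= z < k) R by lia.
    by rewrite -has_count; apply/hasP; exists y; rewrite ?leqnn.
  have := RU k; have := RU y.
  have [+ _] := row_insertP y sU; case: (row_insert y U) => U1 [z|] /=.
    move=> [yz zU knU hU]; have /permP cU := knuth_perm knU.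
    have := cU (fun z => z <= k); rewrite count_cat /= addn0 => {}cU.
    have cy : k < z -> y <= k -> count (fun z => z <= k) U = count (fun z => z <= y) U.
      move=> kz yk'; apply: eq_in_count => u /(allP hU); lia.
    case: (leqP z k) => kz; first by lia.
    by case: (leqP y k) => yk'; [have := cy kz yk'|]; lia.
  move=> [-> hU]; rewrite -cats1 count_cat /= addn0.
  have cy : y <= k -> count (fun z => z <= k) U = count (fun z => z <= y) U.
    by move=> yk'; apply: eq_in_count => u /(allP hU); lia.
  by case: (leqP y k) => yk'; [have := cy yk'|]; lia.
by move=> [-> _]; rewrite -cats1 count_cat; have := RU k; lia.
Qed.

(** * Tableaux and insertion *)

Fixpoint tableau (T : seq (seq nat)) : Prop :=
  if T is R :: T' then
    [/\ sorted leq R, strictly_below R (head [::] T') & tableau T']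
  else True.

Fixpoint tab_insert (T : seq (seq nat)) x :=
  if T is R :: T' then
    (row_insert x R).1 ::
      (if (row_insert x R).2 is Some y then tab_insert T' y else T')
  else [:: [:: x]].

Lemma head_tab_insert T x : head [::] (tab_insert T x) = (row_insert x (head [::] T)).1.
Proof. by case: T. Qed.

Lemma tableau_head T : tableau T -> sorted leq (head [::] T).
Proof. by case: T => //= R T []. Qed.

Lemma tableau_insert T x : tableau T -> tableau (tab_insert T x).
Proof.
elim: T x => [|R T IH] x /=; first by move=> _; split=> // k; case: ltnP.
move=> [sR RT tT]; have [_ sR1] := row_insertP x sR; split=> //.
  have := strictly_below_insert x sR (tableau_head tT) RT.
  by case: (row_insert x R).2 => // y; rewrite head_tab_insert.
by case: (row_insert x R).2 => // y; apply: IH.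
Qed.

Lemma rrw_cons R T : rrw (R :: T) = rrw T ++ R.
Proof. by rewrite /rrw rev_cons flatten_rcons. Qed.

Lemma knuth_tab_insert T x : tableau T -> knuth (rrw T ++ [:: x]) (rrw (tab_insert T x)).
Proof.
elim: T x => [|R T IH] x /=; first by move=> _; exact: WordCongRefl.
move=> [sR RT tT]; have [+ _] := row_insertP x sR.
rewrite !rrw_cons; case: (row_insert x R) => R1 [y|] /=.
  move=> [_ _ kn _]; rewrite -catA.
  apply: (WordCongTrans (v := (rrw T ++ [:: y]) ++ R1)).
    by rewrite -catA; apply: word_cong_cat kn; exact: WordCongRefl.
  by apply: word_cong_cat (IH _ tT) _; exact: WordCongRefl.
by move=> [-> _]; rewrite -catA cats1; exact: WordCongRefl.
Qed.

Lemma knuth_tableau w : exists2 T, tableau T & knuth w (rrw T).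
Proof.
suff H : forall T, tableau T -> exists2 T', tableau T' & knuth (rrw T ++ w) (rrw T').
  by have [//|T ? ?] := H [::]; exists T.
elim: w => [|x w IH] T tT; first by exists T => //; rewrite cats0; exact: WordCongRefl.
have [T' tT' kn] := IH _ (tableau_insert x tT); exists T' => //.
apply: WordCongTrans kn; rewrite -cat1s catA.
by apply: word_cong_cat (WordCongRefl _ _); apply: knuth_tab_insert.
Qed.

(** * Collapsing words and tableaux *)

Definition lower_int b w := foldr (fun i u => lower i 0 u) w (iota 1 b).

Fixpoint collapse_word k w :=
  if k is k'.+1 then lower_int k (collapse_word k' w) else w.

Lemma knuth_collapse k u v : knuth u v -> knuth (collapse_word k u) (collapse_word k v).
Proof.
move=> uv; elim: k => //= k IH; rewrite /lower_int.
by elim: (iota 1 k.+1) => //= i s IHs; have [] := knuth_lower i IHs 0.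
Qed.

Section CollapseTableau.
Variable k : nat.

(* Row [r] during the [k]-th collapsing round, once [lower k], ..., [lower j]
   have been applied. *)
Definition stage_row r j (R : seq nat) :=
  [seq if x <= k then r else if x == k.+1 then maxn r j else x | x <- R].

Fixpoint stage r j T :=
  if T is R :: T' then stage r.+1 j T' ++ stage_row r j R else [::].

(** Such rows contain neither [j] nor [j.+1] at this moment. *)
Lemma stage_high r j T c : j <= k -> j.+1 < r ->
  lower j c (stage r j.+1 T) = stage r j T.
Proof.
move=> jk; elim: T r c => //= R T IH r c jr.
rewrite lower_cat IH; last by lia.
congr (_ ++ _); elim: R => //= x R ->; congr (_ :: _).
by case: (leqP x k) => ?; case: (eqVneq x k.+1) => ?; case: eqP => //= ?; lia.
Qed.

(** The letters [j.+1] of this row come from its entries up to [k.+1], and the [c] free letters [j]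
    to the right match them all. *)
Lemma stage_matched j T c : j <= k -> count (fun x => x <= k.+1) (head [::] T) <= c ->
  lower j c (stage j.+1 j.+1 T) = stage j.+1 j T.
Proof.
move=> jk; case: T => //= R T hc; rewrite lower_cat stage_high //; congr (_ ++ _).
suff [] : lower j c (stage_row j.+1 j.+1 R) = stage_row j.+1 j R /\
  rqueue j c (stage_row j.+1 j.+1 R) = c - count (fun x => x <= k.+1) R by [].
elim: R hc => [|x R IH] /=; first by rewrite subn0.
move=> hc; have [-> ->] := IH (leq_trans (leq_addl _ _) hc).
by case: (leqP x k) => ?; case: (eqVneq x k.+1) => ?; split; (try congr (_ :: _));
  case: eqP => //= ?; try case: eqP => //= ?; lia.
Qed.

(** The entries [k.+1] of row [j], now letters [j.+1], stand to the right of all letters [j] and so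
    drop. The entries up to [k] are the letters [j]; by column strictness at [k.+1] they match all
    letters [j.+1] of the row above. *)
Lemma stage_split j T : 0 < j <= k -> tableau T -> lower j 0 (stage j j.+1 T) = stage j j T.
Proof.
move=> jk; case: T => //= R T [sR RT _]; rewrite lower_cat.
suff [-> ->] : lower j 0 (stage_row j j.+1 R) = stage_row j j R /\
    rqueue j 0 (stage_row j j.+1 R) = count (fun x => x <= k) R.
  by rewrite stage_matched ?RT //; lia.
elim: R sR {RT} => //= x R IH xR; have [-> ->] := IH (path_sorted xR).
have := order_path_min leq_trans xR.
case: (leqP x k) => xk; first by rewrite eqxx ltn_eqF.
move=> hx; have -> : count (fun x => x <= k) R = 0.
  apply/eqP; rewrite eqn0Ngt -has_count; apply/hasPn => z /(allP hx); lia.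
by case: (eqVneq x k.+1) => ?; split; (try congr (_ :: _));
  case: eqP => //= ?; try case: eqP => //= ?; lia.
Qed.

(** Below row [j] there is no letter [j], and the letters [j.+1] are the entries [k.+1] on their way
    down; all of them are lowered. *)
Lemma stage_low r j T : 0 < r <= j -> j <= k -> tableau T ->
  lower j 0 (stage r j.+1 T) = stage r j T.
Proof.
move=> + jk; elim: T r => //= R T IH r rj tT.
have [e|nrj] := eqVneq r j.
  by have := stage_split (j := j) (T := R :: T); rewrite e /= => -> //; lia.
have [_ _ tT'] := tT; rewrite lower_cat.
suff [-> ->] : lower j 0 (stage_row r j.+1 R) = stage_row r j R /\
    rqueue j 0 (stage_row r j.+1 R) = 0 by rewrite IH //; lia.
elim: R {tT} => //= x R [-> ->].
by case: (leqP x k) => ?; case: (eqVneq x k.+1) => ?; split; (try congr (_ :: _));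
  case: eqP => //= ?; try case: eqP => //= ?; lia.
Qed.

Lemma lower_int_stage T : tableau T -> lower_int k (stage 1 k.+1 T) = stage 1 1 T.
Proof.
move=> tT; have H m : m <= k -> lower_int m (stage 1 m.+1 T) = stage 1 1 T.
  elim: m => // m IH mk; rewrite /lower_int -(addn1 m) iotaD foldr_cat /=.
  by rewrite addn1 add1n stage_low // -IH // ltnW.
exact: H.
Qed.

End CollapseTableau.

(** * Tableaux after complete rounds *)

Fixpoint flat r k T :=
  if T is R :: T' then flat r.+1 k T' ++ [seq if x <= k then r else x | x <- R] else [::].

Fixpoint rows_ge r T :=
  if T is R :: T' then all (fun x => r <= x) R && rows_ge r.+1 T' else true.

Lemma tableau_rows_ge r T : tableau T -> all (fun x => r <= x) (head [::] T) -> rows_ge r T.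
Proof.
elim: T r => //= R T IH r [_ RT tT] hR; rewrite hR; apply: IH => //.
apply/allP => x xT; rewrite ltnNge; apply/negP => xr.
have := RT r; have -> : count (fun x => x < r) R = 0.
  by apply/eqP; rewrite eqn0Ngt -has_count; apply/hasPn => z /(allP hR); lia.
suff : 0 < count (fun x => x <= r) (head [::] T) by lia.
by rewrite -has_count; apply/hasP; exists x.
Qed.

Lemma flat_stage_start k r T : rows_ge r T -> flat r k T = stage k r k.+1 T.
Proof.
elim: T r => //= R T IH r /andP[hR /IH->]; congr (_ ++ _).
apply/eq_in_map => x /(allP hR) rx; case: leqP => // kx.
by case: eqP => // ?; lia.
Qed.

Lemma flat_stage_end k r j T : j <= r -> flat r k.+1 T = stage k r j T.
Proof.
elim: T r => //= R T IH r jr; rewrite IH; last exact: leqW.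
congr (_ ++ _); apply: eq_map => x.
by case: (leqP x k) => ?; case: (eqVneq x k.+1) => ?; case: ltnP => ?; lia.
Qed.

Lemma flat_start r T : 0 < r -> rows_ge r T -> flat r 1 T = rrw T.
Proof.
elim: T r => //= R T IH r r1 /andP[hR hT]; rewrite rrw_cons IH //; congr (_ ++ _).
by rewrite -[RHS]map_id; apply/eq_in_map => x /(allP hR) rx; case: leqP => // ?; lia.
Qed.

(** Round [k] takes the entries [k.+1] down to their row numbers, where all smaller entries already
    are; its end is the start of the next round. *)
Lemma collapse_tableau k T : tableau T -> rows_ge 1 T ->
  collapse_word k (rrw T) = flat 1 k.+1 T.
Proof.
move=> tT rT; elim: k => [|k IH] /=; first by rewrite flat_start.
by rewrite IH flat_stage_start // lower_int_stage // -flat_stage_end.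
Qed.

Lemma count_flat r k T m : r <= m <= k ->
  count_mem m (flat r k T) = count (fun x => x <= k) (nth [::] T (m - r)).
Proof.
elim: T r => [|R T IH] r hm /=; first by rewrite nth_nil.
rewrite count_cat; have [->|nmr] := eqVneq m r.
  rewrite subnn /= count_map.
  have -> : count_mem r (flat r.+1 k T) = 0.
    have : r < r.+1 by []; move: {2 3}r.+1 => r' rr'.
    elim: T r' rr' {IH} => //= U T IH r' rr'; rewrite count_cat IH ?leqW // add0n.
    rewrite count_map; apply/eqP; rewrite eqn0Ngt -has_count; apply/hasPn => x _ /=.
    by case: leqP => ?; lia.
  by rewrite add0n; apply: eq_count => x /=; case: (leqP x k) => ?; lia.
rewrite IH; last by lia.
have -> : m - r = (m - r.+1).+1 by lia.
rewrite /= -[RHS]addn0; congr (_ + _).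
rewrite count_map; apply/eqP; rewrite eqn0Ngt -has_count; apply/hasPn => x _ /=.
by case: leqP => ?; lia.
Qed.

Lemma rows_ge_nth r T m : rows_ge r T -> all (fun x => r + m <= x) (nth [::] T m).
Proof.
elim: T r m => [|R T IH] r [|m] //= /andP[hR hT]; first by rewrite addn0.
by rewrite addnS -addSn; apply: IH.
Qed.

Lemma tableau_sorted_nth T m : tableau T -> sorted leq (nth [::] T m).
Proof. by elim: T m => [|R T IH] [|m] //= [sR _ tT] //; apply: IH. Qed.

(** A sorted row is determined by its cumulative counts, and [rhoQ_row] is built from their
    differences. *)
Lemma sorted_flatten_nseq (R : seq nat) a L : sorted leq R ->
  all (fun x => a < x <= a + L) R ->
  flatten [seq nseq (count (fun x => x <= i) R - count (fun x => x <= i.-1) R) i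
          | i <- iota a.+1 L] = R.
Proof.
move=> sR hR; apply: (sorted_eq leq_trans anti_leq) => //.
  elim: L a {hR} => //= L IH a.
  have := IH a.+1; set s := flatten _ => ss.
  have hs : all (fun x => a < x) s.
    apply/allP => x /flattenP[u /mapP[i]]; rewrite mem_iota => hi -> /nseqP[-> _]; lia.
  elim: (_ - _) => //= d IHd; rewrite (path_sortedE leq_trans) IHd andbT all_cat hs andbT.
  by apply/allP => x /nseqP[-> _] /=.
apply/permP => P; rewrite count_flatten -map_comp.
have -> : count P R = \sum_(x <- R) P x by rewrite -sum1_count big_mkcond; apply: eq_bigr => x _; case: (P x).
rewrite sumnE big_map.
under eq_bigr do rewrite /= count_nseq.
under [RHS]eq_big_seq => x xR.
  have -> : (P x : nat) = \sum_(i <- iota a.+1 L) P i * (x == i).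
    rewrite (bigD1_seq x) ?iota_uniq //= ?mem_iota; last by have := allP hR x xR; lia.
    by rewrite eqxx muln1 big1 ?addn0 // => i /negbTE; rewrite eq_sym => ->; rewrite muln0.
  over.
rewrite exchange_big /=; apply: eq_big_seq => i; rewrite mem_iota => hi.
rewrite -big_distrr /=; congr (_ * _).
have -> : \sum_(x <- R) (x == i) = count_mem i R by rewrite -sum1_count [RHS]big_mkcond; apply: eq_bigr => x _ /=; case: (x == i).
have : count (fun x => x <= i) R = count (fun x => x <= i.-1) R + count_mem i R.
  by elim: (R) => //= x R' ->; lia.
by move=> ->; rewrite addKn.
Qed.

(** [rho_Q] has as many rows as the matrix, while the tableau found by insertion may have another
    number; the difference consists of empty rows. *)
Lemma flatten_rev_mkseq (T : seq (seq nat)) L :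
  (forall m, L <= m -> nth [::] T m = [::]) ->
  flatten (rev (mkseq (nth [::] T) L)) = flatten (rev T).
Proof.
have e0 (s : seq (seq nat)) : (forall m, nth [::] s m = [::]) -> flatten (rev s) = [::].
  elim: s => // u s IH h; have /= -> := h 0; rewrite rev_cons flatten_rcons cats0.
  exact: IH (fun m => h m.+1).
elim: T L => [|R T IH] L hL.
  apply: e0 => m; case: (ltnP m L) => mL; first by rewrite nth_mkseq // nth_nil.
  by rewrite nth_default // size_mkseq.
case: L hL => [|L] hL; first by rewrite (e0 (R :: T)) // => m; apply: hL.
rewrite /mkseq /= -(addn0 1) iotaDl -map_comp !rev_cons !flatten_rcons -(IH L) //.
by move=> m Lm; apply: (hL m.+1).
Qed.

(** * Collapsing matrices *)

Section Unmatched.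
Variables (T : Type) (f : T -> nat) (i : nat).

(** Generic in [T], since the same bracketing is needed for pairs of position and letter, for
    positions and for cells. *)
Fixpoint unmatched c (s : seq T) : seq T :=
  if s is x :: s' then
    if (f x == i.+1) && (rqueue i c (map f s') == 0) then x :: unmatched c s'
    else unmatched c s'
  else [::].

Lemma unmatched_cat c s1 s2 :
  unmatched c (s1 ++ s2) = unmatched (rqueue i c (map f s2)) s1 ++ unmatched c s2.
Proof. by elim: s1 => //= x s ->; rewrite map_cat rqueue_cat; case: ifP. Qed.

Lemma unmatched_filter c s :
  unmatched c [seq x <- s | (f x == i) || (f x == i.+1)] = unmatched c s /\
  rqueue i c (map f [seq x <- s | (f x == i) || (f x == i.+1)]) = rqueue i c (map f s).
Proof.
elim: s => //= x s [IH1 IH2]; case: ifP => [|/negbT]; rewrite /= ?IH1 ?IH2 //.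
by rewrite negb_or => /andP[/negbTE-> /negbTE->].
Qed.

End Unmatched.

Lemma unmatched_map T U (g : U -> T) (f : T -> nat) i c s :
  unmatched f i c (map g s) = map g (unmatched (f \o g) i c s).
Proof. by elim: s => //= x s ->; rewrite -map_comp; case: ifP. Qed.

Lemma eq_in_unmatched (T : eqType) (f g : T -> nat) i c s : {in s, f =1 g} ->
  unmatched f i c s = unmatched g i c s.
Proof.
elim: s => //= x s IH h; rewrite IH; last by move=> y ys; apply: h; rewrite inE ys orbT.
rewrite h ?mem_head //; congr (if _ && (rqueue _ _ _ == _) then _ else _).
by apply/eq_in_map => y ys; apply: h; rewrite inE ys orbT.
Qed.

Lemma unmatched_subset (T : eqType) (f : T -> nat) i c s x :
  x \in unmatched f i c s -> x \in s /\ f x = i.+1.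
Proof.
elim: s => //= y s IH; case: ifP => [/andP[/eqP fy _]|_]; rewrite !inE.
  by case/predU1P => [->|/IH[-> ->]]; rewrite ?eqxx ?orbT.
by move=> /IH[-> ->]; rewrite orbT.
Qed.

(** The two letters match each other. In a column word this shows that a ball unmatched above has an
    empty cell below it. *)
Lemma unmatched_adjacent (T : eqType) (f : T -> nat) i c p s x y :
  uniq (p ++ x :: y :: s) -> f y = i -> x \notin unmatched f i c (p ++ x :: y :: s).
Proof.
rewrite cat_uniq => /and3P[_ /hasPn xp /andP[xs _]] fy.
rewrite unmatched_cat mem_cat negb_or; apply/andP; split.
  by apply/negP => /unmatched_subset[xp']; have := xp x (mem_head _ _); rewrite xp'.
rewrite /= fy (ltn_eqF (ltnSn i)) eqxx andbF.
by apply/negP => /unmatched_subset[xs']; move: xs; rewrite inE xs' orbT.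
Qed.

Lemma lower_map (T : eqType) (f : T -> nat) i c s : uniq s ->
  lower i c (map f s) = [seq if x \in unmatched f i c s then i else f x | x <- s].
Proof.
elim: s => //= x s IH /andP[xs us]; rewrite IH //.
have xu : (x \in unmatched f i c s) = false.
  by apply/negP => /unmatched_subset[]; rewrite (negbTE xs).
have E : {in s, forall y, (y \in x :: unmatched f i c s) = (y \in unmatched f i c s)}.
  by move=> y ys; rewrite inE; case: eqP => // e; rewrite -e ys in xs.
case: ifP => _; rewrite ?mem_head ?xu; congr (_ :: _) => //.
by apply/eq_in_map => y /E ->.
Qed.

(** A cancelled pair leaves the counter unchanged for everything on its left. *)
Lemma par_step_some i s s' : par_step i s = Some s' ->
  [/\ size s = (size s').+2, {subset s' <= s},
      rqueue i 0 (map snd s) = rqueue i 0 (map snd s') &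
      unmatched snd i 0 s = unmatched snd i 0 s'].
Proof.
elim: s s' => [//|x [//|y t] IH] s'.
rewrite [par_step _ _]/=; case: ifP => [/andP[/eqP hx /eqP hy] [<-]|hxy].
  split=> //; first by move=> z zt; rewrite !inE zt !orbT.
    by rewrite /= hx hy (ltn_eqF (ltnSn i)) !eqxx.
  by rewrite /= hx hy (ltn_eqF (ltnSn i)) !eqxx.
rewrite -/(par_step i (y :: t)); case E: (par_step i (y :: t)) => [t'|] //= [<-].
have [h1 h2 h3 h4] := IH _ E; split.
- by rewrite /= -h1.
- by move=> z; rewrite !inE => /orP[->//|/h2]; rewrite inE => ->; rewrite orbT.
- by move: h3 => /= ->.
- by move: h3 h4 => /= -> ->.
Qed.

(** When nothing cancels, all letters [i] precede all letters [i.+1], so each [i.+1] is met with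
    counter 0. *)
Lemma par_step_none i s : all (fun x => (x.2 == i) || (x.2 == i.+1)) s ->
  par_step i s = None -> unmatched snd i 0 s = [seq x <- s | x.2 == i.+1].
Proof.
have tail x t : par_step i (x :: t) = None -> par_step i t = None.
  case: t => // y t; rewrite [par_step i (x :: _)]/= -/(par_step i (y :: t)).
  by case: ifP => // _; case: (par_step i (y :: t)).
have q0 x t : all (fun x => (x.2 == i) || (x.2 == i.+1)) t ->
    par_step i (x :: t) = None -> x.2 = i.+1 -> rqueue i 0 (map snd t) = 0.
  elim: t x => // y t IH x /andP[hy ht] pn hx; have pt := tail _ _ pn.
  move: pn => /=; rewrite hx eqxx /=; case: eqP => [//|/eqP ny] _.
  move: hy; rewrite (negbTE ny) /= => /eqP hy.
  by rewrite (IH y) // hy eqxx.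
elim: s => //= x s IH /andP[hx hs] pn; rewrite IH ?(tail _ _ pn) //.
by case: eqP => // ex; rewrite (q0 x).
Qed.

Lemma par_reduceP i m s : size s <= m -> all (fun x => (x.2 == i) || (x.2 == i.+1)) s ->
  {subset par_reduce i m s <= s} /\
  [seq x <- par_reduce i m s | x.2 == i.+1] = unmatched snd i 0 s.
Proof.
elim: m s => [|m IH] s; first by case: s.
move=> hs ha /=; case E: (par_step i s) => [s'|]; last by split=> //; rewrite par_step_none.
have [h1 h2 _ ->] := par_step_some E.
have hs' : size s' <= m by apply: ltnW; rewrite -ltnS -h1.
have [|s1 s2] := IH s' hs'; first by apply/allP => x /h2; move/allP: ha; apply.
by split=> // x /s1/h2.
Qed.

Lemma unmatched_above_colsE n i B :
  unmatched_above_cols n i B = map snd (unmatched fst i 0 (cw_cells n B)).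
Proof.
rewrite /unmatched_above_cols /unmatched_pos; set C := cw_cells n B; set w := map fst C.
set s := [seq x <- zip _ _ | _]; have [sub E] := par_reduceP (leqnn (size s)) (filter_all _ _).
set P := par_reduce i (size s) s in sub E *.
have zE : zip (iota 0 (size w)) w = [seq (p, nth 0 w p) | p <- iota 0 (size w)].
  by rewrite -{2}(mkseq_nth 0 w) /mkseq -{1}(map_id (iota 0 (size w))) zip_map.
have hP x : x \in P -> x.2 = nth 0 w x.1.
  by move/sub; rewrite mem_filter zE => /andP[_ /mapP[p _ ->]].
have -> : [seq p <- map fst P | nth 0 w p == i.+1] = map fst [seq x <- P | x.2 == i.+1].
  by rewrite filter_map; congr (map _ _); apply: eq_in_filter => x /hP ->.
have [uf _] := unmatched_filter snd i 0 (zip (iota 0 (size w)) w).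
rewrite E /s uf zE unmatched_map -map_comp.
have sw : size w = size C by rewrite size_map.
rewrite -[in RHS](mkseq_nth (0, 0) C) /mkseq unmatched_map -!map_comp sw.
congr (map _ _); apply: eq_in_unmatched => p; rewrite mem_iota => hp /=.
by rewrite (nth_map (0, 0)).
Qed.

(** The reading order of the column word. *)
Definition cell_lt : rel (nat * nat) :=
  fun x y => (x.2 < y.2) || (x.2 == y.2) && (y.1 < x.1).

Lemma cell_lt_irr : irreflexive cell_lt.
Proof. by move=> x; rewrite /cell_lt !ltnn andbF. Qed.

Lemma cell_lt_trans : transitive cell_lt.
Proof. by move=> y x z; rewrite /cell_lt; lia. Qed.

Lemma mem_cw_cells n B x :
  (x \in cw_cells n B) = [&& 0 < x.1 <= size B, 0 < x.2 <= n & cell B x.1 x.2].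
Proof.
case: x => r j; apply/flattenP/and3P => [[u /mapP[j' hj' ->]] /mapP[r']|[hr hj c]].
  rewrite mem_filter mem_rev !mem_iota in hj' * => /andP[c hr] [-> ->].
  by split=> //=; lia.
rewrite /= in hr hj c.
exists [seq (r, j) | r <- rev (iota 1 (size B)) & cell B r j].
  by apply: map_f; rewrite mem_iota; lia.
by apply: map_f; rewrite mem_filter c mem_rev mem_iota /=; lia.
Qed.

Lemma sorted_cw_cells n B : sorted cell_lt (cw_cells n B).
Proof.
rewrite (sorted_pairwise cell_lt_trans) /cw_cells; move: (iota_ltn_sorted 1 n).
elim: (iota 1 n) => //= j s IH js; rewrite pairwise_cat IH ?(path_sorted js) // andbT.
apply/andP; split.
  apply/allrelP => x y /mapP[r _ ->] /flattenP[u /mapP[j' hj' ->] /mapP[r' _ ->]].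
  by rewrite /cell_lt /= (allP (order_path_min ltn_trans js)).
rewrite -(sorted_pairwise cell_lt_trans) sorted_map.
apply: sorted_filter; first by move=> a b c; rewrite /relpre /cell_lt /=; lia.
rewrite rev_sorted; apply: sub_sorted (iota_ltn_sorted _ _) => a b ab.
by rewrite /relpre /cell_lt /= eqxx orbC /=; move: ab => /= ->.
Qed.

Lemma uniq_cw_cells n B : uniq (cw_cells n B).
Proof. exact: (sorted_uniq cell_lt_trans cell_lt_irr (sorted_cw_cells n B)). Qed.

Lemma cwE n B :
  cw n B = flatten [seq [seq r <- rev (iota 1 (size B)) | cell B r j] | j <- iota 1 n].
Proof.
rewrite /cw /cw_cells map_flatten -map_comp; congr flatten; apply: eq_map => j /=.
by rewrite -map_comp map_id.
Qed.

Lemma count_cw n B r : is_matrix n B -> 0 < r <= size B ->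
  count_mem r (cw n B) = count id (brow B r).
Proof.
move=> mB hr; rewrite cwE count_flatten -map_comp.
have sz : size (brow B r) = n by apply/eqP; apply: (allP mB); apply: mem_nth; case/andP: hr => r0; rewrite prednK.
rewrite -[in RHS](mkseq_nth false (brow B r)) sz count_map.
have -> : iota 1 n = [seq j.+1 | j <- iota 0 n] by rewrite -(addn0 1) iotaDl.
rewrite -map_comp sumnE big_map -sum1_count [RHS]big_mkcond /=; apply: eq_bigr => j _ /=.
rewrite count_filter (eq_count (a2 := fun r0 => (r0 == r) && cell B r0 j.+1)) //.
have -> (s : seq nat) : count (fun r0 => (r0 == r) && cell B r0 j.+1) s =
    count_mem r s * cell B r j.+1.
  by elim: s => //= a s ->; rewrite mulnDl; case: eqP => [->|_]; rewrite ?mul1n.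
rewrite count_uniq_mem ?rev_uniq ?iota_uniq // mem_rev mem_iota.
have -> : (1 <= r < 1 + size B) by lia.
by rewrite mul1n /cell /=; case: nth.
Qed.

Lemma size_estar n i B : size (estar n i B) = size B.
Proof. by rewrite size_map size_iota. Qed.

Lemma matrix_estar n i B : is_matrix n (estar n i B).
Proof. by apply/allP => u /mapP[r _ ->]; rewrite size_map size_iota. Qed.

Lemma cell_estar n i B r j : 0 < r <= size B -> 0 < j <= n ->
  cell (estar n i B) r j =
  (let U := unmatched_above_cols n i B in
   if (r == i) && (j \in U) then true
   else if (r == i.+1) && (j \in U) then false else cell B r j).
Proof.
move=> hr hj; rewrite {1}/cell /brow (nth_map 0) ?size_iota; last by lia.
rewrite (nth_map 0) ?size_iota; last by lia.
by rewrite !nth_iota; try lia; rewrite !add1n !prednK //; lia.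
Qed.

(** A moved ball goes to the cell read immediately after its own, which is empty; its letter changes
    from [i.+1] to [i] without changing place in the word. *)
Lemma cw_estar n i B : 0 < i < size B -> cw n (estar n i B) = lower i 0 (cw n B).
Proof.
move=> hi; rewrite {2}/cw lower_map ?uniq_cw_cells // cwE size_estar.
set U := unmatched fst i 0 (cw_cells n B).
have EU := unmatched_above_colsE n i B; rewrite -/U in EU.
have memU r j : ((r, j) \in U) = (r == i.+1) && (j \in map snd U).
  apply/idP/andP => [rU|[/eqP-> /mapP[[r' j'] rU ->]]].
    by have [_ /= ->] := unmatched_subset rU; rewrite eqxx; split=> //; apply/mapP; exists (r, j).
  by have [_ /= <-] := unmatched_subset rU.
rewrite /cw_cells map_flatten -map_comp; congr flatten; apply/eq_in_map => j.
rewrite mem_iota => hj /=; rewrite -map_comp.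
have ce : {in rev (iota 1 (size B)), forall r, cell (estar n i B) r j =
   (if (r == i) && (j \in map snd U) then true
    else if (r == i.+1) && (j \in map snd U) then false else cell B r j)}.
  move=> r; rewrite mem_rev mem_iota => hr; rewrite cell_estar; try lia.
  by rewrite EU.
rewrite (eq_in_filter ce).
have -> : [seq ((fun x => if x \in U then i else x.1) \o (fun r => (r, j))) r
          | r <- rev (iota 1 (size B)) & cell B r j] =
   [seq if (r == i.+1) && (j \in map snd U) then i else r
          | r <- rev (iota 1 (size B)) & cell B r j].
  by apply: eq_map => r /=; rewrite memU.
case jU: (j \in map snd U); last first.
  under eq_filter do rewrite !andbF.
  by rewrite -[LHS]map_id; apply: eq_map => r; rewrite andbF.
have rU : (i.+1, j) \in U by rewrite memU eqxx.
have [] := unmatched_subset rU; rewrite mem_cw_cells => /and3P[_ _ /= c1] _.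
have siota : rev (iota 1 (size B)) =
    rev (iota i.+2 (size B - i.+1)) ++ [:: i.+1; i] ++ rev (iota 1 i.-1).
  have -> : size B = i.-1 + 2 + (size B - i.+1) by lia.
  rewrite !iotaD !rev_cat; have -> : 1 + i.-1 = i by lia.
  have -> : 1 + (i.-1 + 2) = i.+2 by lia.
  by have -> : i.-1 + 2 + (size B - i.+1) - i.+1 = size B - i.+1 by lia.
(* A ball there would be read right after [(i.+1, j)] and match it. *)
have c2 : cell B i j = false.
  apply/negP => c2; suff : (i.+1, j) \notin U by rewrite rU.
  have [p [s es]] : exists p s, cw_cells n B = p ++ (i.+1, j) :: (i, j) :: s.
    rewrite /cw_cells; have -> : n = j.-1 + (1 + (n - j)) by lia.
    rewrite !iotaD !map_cat !flatten_cat /=; have -> : 1 + j.-1 = j by lia.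
    rewrite siota !filter_cat /= c1 c2 !map_cat /= -!catA /= catA.
    by eexists; eexists; reflexivity.
  by have := uniq_cw_cells n B; rewrite /U es => us; apply: unmatched_adjacent.
have hid (s : seq nat) : i \notin s -> i.+1 \notin s ->
    [seq r <- s | if (r == i) && true then true else
                  if (r == i.+1) && true then false else cell B r j] =
    [seq if (r == i.+1) && true then i else r | r <- s & cell B r j].
  elim: s => //= r s IH; rewrite !inE !negb_or => /andP[n1 h1] /andP[n2 h2].
  rewrite IH // !andbT [r == i]eq_sym (negbTE n1) [r == i.+1]eq_sym (negbTE n2).
  by case: ifP => //= _; rewrite eq_sym (negbTE n2).
rewrite siota !filter_cat !map_cat (hid (rev (iota i.+2 _))) ?(hid (rev (iota 1 _)));
  rewrite ?mem_rev ?mem_iota; try lia.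
by rewrite /= !eqxx (gtn_eqF (ltnSn i)) c1 c2 /= eqxx.
Qed.

Lemma size_collapseD n k B : size (collapseD n k B) = size B.
Proof.
elim: k => //= k <-; rewrite /estar_int; elim: (iota _ _) => //= i s.
by rewrite size_estar.
Qed.

Lemma matrix_collapseD n k B : is_matrix n B -> is_matrix n (collapseD n k B).
Proof. by case: k => //= k _; rewrite /estar_int /= matrix_estar. Qed.

Lemma cw_collapseD n k B : k < size B -> cw n (collapseD n k B) = collapse_word k (cw n B).
Proof.
elim: k => // k IH kB; rewrite [RHS]/= -IH; last exact: ltnW.
rewrite [collapseD _ _ _]/=.
rewrite /estar_int /lower_int subn1 [k.+2.-1]/=.
have : all (fun i => 0 < i < size (collapseD n k B)) (iota 1 k.+1).
  by apply/allP => i; rewrite mem_iota size_collapseD; lia.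
have se s : size (foldr (estar n) (collapseD n k B) s) = size (collapseD n k B).
  by elim: s => //= i s; rewrite size_estar.
by elim: (iota 1 k.+1) => //= i s IHs /andP[hi /IHs <-]; rewrite cw_estar // se.
Qed.

(** Letter counts are invariant under Knuth equivalence, so the balls of row [r] can be counted on
    the collapsed [T], where the letters [r] come exactly from the entries up to [k] of row [r]. *)
Lemma NsizeE n B T k r : is_matrix n B -> tableau T -> rows_ge 1 T ->
  knuth (cw n B) (rrw T) -> 0 < r -> k <= size B ->
  Nsize n B k r = count (fun x => x <= k) (nth [::] T r.-1).
Proof.
move=> mB tT rT kn r0 kB; rewrite /Nsize r0 /=; case: leqP => rk; last first.
  apply/esym/eqP; rewrite eqn0Ngt -has_count; apply/hasPn => x.
  by move/(allP (rows_ge_nth r.-1 rT)); lia.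
rewrite -(@count_cw n) ?matrix_collapseD ?size_collapseD //; last by lia.
rewrite cw_collapseD; last by lia.
have /permP -> := knuth_perm (knuth_collapse k.-1 kn).
by rewrite collapse_tableau // prednK ?count_flat ?subn1 //; lia.
Qed.

Lemma rrw_rho_Q n B T : is_matrix n B -> tableau T ->
  knuth (cw n B) (rrw T) -> rrw (rho_Q n B) = rrw T.
Proof.
move=> mB tT kn.
have /perm_mem mT := knuth_perm kn.
have hx x : x \in rrw T -> 0 < x <= size B.
  rewrite -mT => /mapP[c]; rewrite mem_cw_cells => /and3P[hc _ _] ->; exact: hc.
have rowT m x : x \in nth [::] T m -> x \in rrw T.
  move=> xm; apply/flattenP; exists (nth [::] T m) => //; rewrite mem_rev.
  apply: mem_nth; rewrite ltnNge; apply/negP => /(nth_default [::]) e.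
  by rewrite e in xm.
have rT : rows_ge 1 T.
  apply: tableau_rows_ge => //; apply/allP => x; rewrite -nth0 => /rowT/hx; lia.
have -> : rho_Q n B = mkseq (nth [::] T) (size B).
  rewrite /rho_Q /mkseq -(addn0 1) iotaDl -map_comp; apply/eq_in_map => m.
  rewrite mem_iota => hm /=; rewrite /rhoQ_row.
  rewrite -[RHS](@sorted_flatten_nseq _ 0 (size B)); first 1 last.
  - exact: tableau_sorted_nth.
  - by apply/allP => x /rowT/hx; lia.
  congr flatten; apply/eq_in_map => i; rewrite mem_iota => hi.
  by rewrite !(@NsizeE _ _ T) //; lia.
apply: flatten_rev_mkseq => m Bm; case E: (nth [::] T m) => [|x u] //.
have xT : x \in nth [::] T m by rewrite E mem_head.
by have := allP (rows_ge_nth m rT) x xT; have := hx x (rowT _ _ xT); lia.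
Qed.

(** * Ferrari-Martin labelling *)

Lemma park_no_source T (f : T -> nat) i s : ~~ has (source f i) s ->
  queue f i 0 s = 0 /\ park f i 0 s = [seq x <- s | f x < i].
Proof.
elim: s => //= x s IH; rewrite negb_or => /andP[/negbTE sx /IH[q0 p0]].
have -> : queue_upd f i 0 x = 0 by rewrite /queue_upd -/(source f i x) sx; case: ifP.
by rewrite andbF orbF p0.
Qed.

Lemma wraps_filter T (f : T -> nat) i (P : pred T) s : (forall x, f x <= i.+1 -> P x) ->
  wraps f i (filter P s) = wraps f i s.
Proof.
elim: i s => //= i IH s hP.
have hP' x : i.+1 <= f x <= i.+2 -> P x by case/andP => _ /hP.
by rewrite /park_cyc !queue_filter // park_filter // IH // => x fx; apply/hP/leqW.
Qed.

Lemma sum_indicator_leq i l L : i < l <= L ->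
  \sum_(i.+1 <= t < L.+1) (t <= l : nat) = l - i.
Proof.
move=> hl; have -> : \sum_(i.+1 <= t < L.+1) (t <= l : nat) =
    \sum_(i.+1 <= t < l.+1) (t <= l : nat) + \sum_(l.+1 <= t < L.+1) (t <= l : nat).
  by rewrite -big_cat_nat //; lia.
rewrite [X in _ + X]big_nat_cond [X in _ + X]big1 ?addn0; last by move=> t; lia.
rewrite (eq_big_nat _ _ (F2 := fun=> 1)); first by rewrite sum_nat_const_nat; lia.
by move=> t /andP[_]; rewrite ltnS => ->.
Qed.

Definition cols_ge t (o : seq (nat * nat)) := [seq x.1 | x <- o & t <= x.2].

Lemma fm_fromSS n B i lab as1 A' m :
  foldl (fm_pair i.+2) ([::], ballcols n B i.+1, 0)
    (sort (fun a b => b.2 <= a.2) (sort (fun a b => a.1 <= b.1) lab)) = (as1, A', m) ->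
  fm_from n B i.+2 lab = m + fm_from n B i.+1 (as1 ++ [seq (c, i.+1) | c <- A']).
Proof. by move=> E; rewrite [LHS]/= E. Qed.

Section FerrariMartin.
Variables (n : nat) (B : seq (seq bool)).
Let C := cw_cells n B.

Lemma mem_ballcols r j : 0 < r <= size B -> (j \in ballcols n B r) = ((r, j) \in C).
Proof. by move=> hr; rewrite mem_filter mem_cw_cells mem_iota hr /= andbC; congr andb; lia. Qed.

Lemma sorted_ballcols r : sorted ltn (ballcols n B r).
Proof. by apply: (sorted_filter ltn_trans); apply: iota_ltn_sorted. Qed.

Section TwoRows.
Variable i : nat.
Hypothesis hi : 0 < i < size B.

(** A state of the pairing of row [i.+1] with row [i]: [O] holds the columns of balls to be paired,
    [A] those of free places. Lower rows are kept for later levels. *)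
Definition layer (O A : seq nat) :=
  [seq x <- C | [|| x.1 < i, (x.1 == i.+1) && (x.2 \in O) | (x.1 == i) && (x.2 \in A)]].

Lemma uniq_layer O A : uniq (layer O A).
Proof. exact/filter_uniq/uniq_cw_cells. Qed.

Lemma sorted_layer O A : sorted cell_lt (layer O A).
Proof. by apply: (sorted_filter cell_lt_trans); apply: sorted_cw_cells. Qed.

Lemma layer_no_source A : queue fst i 0 (layer [::] A) = 0 /\
  park_cyc fst i (layer [::] A) = [seq x <- C | x.1 < i].
Proof.
have h : ~~ has (source fst i) (layer [::] A).
  apply/hasPn => x; rewrite mem_filter in_nil andbF /= /source => /andP[hx _].
  by apply/eqP => e; move: hx; rewrite e; lia.
have [q0 p0] := park_no_source h; rewrite /park_cyc q0 p0; split=> //.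
rewrite -filter_predI; apply: eq_filter => x /=; rewrite in_nil andbF.
by case: ltnP => //= ?; lia.
Qed.

Lemma count_layer O A : {subset A <= ballcols n B i} -> uniq A ->
  size O <= size A -> count (source fst i) (layer O A) <= count (target fst i) (layer O A).
Proof.
move=> sA uA sOA; apply: leq_trans (leq_trans _ sOA) _.
  rewrite -size_filter -(size_map (pair i.+1) O); apply: uniq_leq_size.
    exact/filter_uniq/uniq_layer.
  move=> [r j]; rewrite !mem_filter /source /= => /and3P[/eqP -> h _].
  by apply: map_f; move: h; rewrite eqxx ltnNge leqW //= gtn_eqF //= orbF.
rewrite -size_filter -(size_map (pair i) A); apply: uniq_leq_size.
  by rewrite map_inj_uniq // => a b [].
move=> x /mapP[j jA ->]; rewrite !mem_filter /target /= eqxx jA /= !orbT /=.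
by rewrite -mem_ballcols ?sA //; lia.
Qed.

(** The chosen place is the cyclic successor of [(i.+1, j)] in reading order: within a column, row
    [i.+1] is read before row [i], so [c = j] is no wrap. The pair can therefore be removed first;
    [Z] stands for the places taken by the remaining balls. *)
Lemma layer_step (O A : seq nat) (j c : nat) b : (i.+1, j) \in C -> j \notin O -> sorted ltn A ->
  {subset A <= ballcols n B i} -> size O < size A -> c \in A -> b = (c < j) ->
  (if b then {in A, forall z, c <= z < j} else {in A, forall z, j <= z -> c <= z}) ->
  queue fst i 0 (layer (j :: O) A) = b + queue fst i 0 (layer O (rem c A)) /\
  forall Z, park_cyc fst i (layer O (rem c A)) =
      [seq x <- C | (x.1 < i) || (x.1 == i) && (x.2 \in Z)] ->
    park_cyc fst i (layer (j :: O) A) =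
      [seq x <- C | (x.1 < i) || (x.1 == i) && (x.2 \in c :: Z)].
Proof.
move=> jC jO sA subA sOA cA eb hb; set s := layer (j :: O) A.
have uA : uniq A by apply: sorted_uniq sA; [exact: ltn_trans|exact: ltnn].
set x := (i.+1, j); set y := (i, c).
have yC : y \in C by rewrite -mem_ballcols ?subA //; lia.
have xs : x \in s by rewrite mem_filter jC /= eqxx mem_head orbT.
have ys : y \in s by rewrite mem_filter yC /= eqxx cA !orbT.
have cn : cyc_next fst i s x y b.
  apply: (cyc_next_sorted cell_lt_irr cell_lt_trans (sorted_layer _ _)) => //.
    by rewrite /cell_lt /=; case: b eb {hb} => eb; clear -eb; lia.
  move=> [r z] zs /= er; have zA : z \in A.
    move: zs; rewrite mem_filter er /= ltnn ltn_eqF //= eqxx /=.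
    by case/andP.
  by case: b eb hb => eb /(_ z zA); rewrite er /cell_lt /=; clear -eb; lia.
have [q0 yp pk] := park_cyc_remove (uniq_layer _ _) cn (count_layer (O := j :: O) subA uA sOA).
have es : [seq z <- s | z \notin [:: x; y]] = layer O (rem c A).
  rewrite -filter_predI; apply: eq_filter => -[r z] /=.
  rewrite !inE /x /y !xpair_eqE mem_rem_uniq // !inE.
  have [er|nr] := eqVneq r i.+1.
    rewrite er (gtn_eqF (ltnSn i)) /= orbF.
    have -> : (i.+1 < i) = false by rewrite ltnNge leqW.
    rewrite /= !orbF; have [->|] := eqVneq z j => //=; by rewrite (negbTE jO).
  have [er|nr'] := eqVneq r i; last by case: (r < i).
  by rewrite er ltnn /=; case: (z == c).
rewrite es in q0 pk; split=> // Z hZ; rewrite hZ in pk.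
have sub : subseq (park_cyc fst i s) C.
  exact: subseq_trans (park_subseq _ _ _ _) (filter_subseq _ _).
rewrite [LHS](elimT (subseq_uniqP (uniq_cw_cells n B)) sub).
apply: eq_in_filter => z zC /=.
have [->|zy] := eqVneq z y; first by rewrite yp /= eqxx mem_head orbT.
have -> : (z \in park_cyc fst i s) = (z \in [seq z <- park_cyc fst i s | z != y]).
  by rewrite mem_filter zy.
rewrite -pk mem_filter zC andbT inE; case: z zy {zC} => r z; rewrite /y xpair_eqE /=.
by case: (r == i) => //= /negbTE ->.
Qed.

(** Labels decrease along [o], so the first ball, of label [l], matters for the thresholds [t <= l],
    and for [t > l] no ball is left to count. Its wrap is thus counted for [i < t <= l], which gives
    the weight [l - i.+1 + 1]. *)
Lemma fm_loop L (o as0 : seq (nat * nat)) (A : seq nat) m0 : sorted ltn A -> {subset A <= ballcols n B i} ->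
  uniq (map fst o) -> {subset map fst o <= ballcols n B i.+1} ->
  sorted (fun a b => b.2 <= a.2) o -> all (fun a => i < a.2 <= L) o -> size o <= size A ->
  exists as1 A', [/\ foldl (fm_pair i.+1) (as0, A, m0) o =
      (as0 ++ as1, A', m0 + \sum_(i.+1 <= t < L.+1) queue fst i 0 (layer (cols_ge t o) A)),
    perm_eq (map fst as1 ++ A') A, map snd as1 = map snd o &
    forall t, park_cyc fst i (layer (cols_ge t o) A) =
      [seq x <- C | (x.1 < i) || (x.1 == i) && (x.2 \in cols_ge t as1)]].
Proof.
elim: o as0 A m0 => [|[j l] o IH] as0 A m0 sA subA uo subo so lo szo.
  exists [::], A; rewrite cats0; split=> //=.
    by rewrite big1 ?addn0 // => t _; have [] := layer_no_source A.
  move=> t; have [_ ->] := layer_no_source A.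
  by apply: eq_filter => x; rewrite in_nil andbF orbF.
move: uo => /= /andP[jo uo]; move: lo => /= /andP[hl lo].
have jC : (i.+1, j) \in C by rewrite -mem_ballcols ?subo ?mem_head //; lia.
have [c [Ec cA hb]] : exists c,
   [/\ (if [seq c <- A | j <= c] is c :: _ then Some c else ohead A) = Some c, c \in A &
     if c < j then {in A, forall z, c <= z < j} else {in A, forall z, j <= z -> c <= z}].
  case E: [seq c <- A | j <= c] => [|c u].
    have na z : z \in A -> z < j.
      move=> zA; rewrite ltnNge; apply/negP => jz; suff : z \in [::] by [].
      by rewrite -E mem_filter jz.
    (* No free place lies weakly to the right of [j], so the leftmost one is taken; it exists by
       [szo]. *)
    case EA: A szo => [//|a A1] _; exists a.
    have aA : a \in A by rewrite EA mem_head.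
    rewrite -EA (na a aA); split=> //; first by rewrite EA.
    move=> z zA; rewrite na // andbT.
    have hA : ohead (filter predT A) = Some a by rewrite filter_predT EA.
    by have [_ _ amin] := ohead_filter_sorted sA hA; apply: amin.
  have [cA jc cmin] := ohead_filter_sorted sA (congr1 ohead E).
  by exists c; split=> //; rewrite ltnNge jc.
have uA : uniq A by apply: sorted_uniq sA; [exact: ltn_trans|exact: ltnn].
have [||||as1 [A' [h1 h2 h3 h4]]] := IH (rcons as0 (c, l)) (rem c A)
   (m0 + (if c < j then l - i.+1 + 1 else 0)) _ _ uo _ (path_sorted so) lo.
- exact: (subseq_sorted ltn_trans (rem_subseq _ _)).
- by move=> z /mem_rem /subA.
- by move=> z zo; apply: subo; rewrite inE zo orbT.
- by rewrite size_rem //; move: szo => /=; lia.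
have omax : all (fun a => a.2 <= l) o.
  apply: (order_path_min (leT := fun a b => b.2 <= a.2) _ so).
  by move=> a b d ab bd; apply: leq_trans bd ab.
have ge_nil t (o' : seq (nat * nat)) : l < t -> map snd o' = map snd o -> cols_ge t o' = [::].
  move=> lt eo; rewrite /cols_ge (eq_in_filter (a2 := pred0)) ?filter_pred0 // => a ao.
  have : a.2 \in map snd o by rewrite -eo map_f.
  by case/mapP => a' /(allP omax) al ->; rewrite leqNgt (leq_ltn_trans al lt).
have ge_cons t a (o' : seq (nat * nat)) : t <= l -> cols_ge t ((a, l) :: o') = a :: cols_ge t o'.
  by rewrite /cols_ge /= => ->.
have ge_skip t a (o' : seq (nat * nat)) : l < t -> cols_ge t ((a, l) :: o') = cols_ge t o'.
  by move=> lt; rewrite /cols_ge /= leqNgt lt.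
have jt t : j \notin cols_ge t o.
  by apply: contra jo => /mapP[a]; rewrite mem_filter => /andP[_ ao] ->; apply: map_f.
have st t : size (cols_ge t o) < size A.
  rewrite size_map size_filter; apply: leq_ltn_trans szo; exact: count_size.
have step t := layer_step (O := cols_ge t o) jC (jt t) sA subA (st t) cA erefl hb.
have Q t : queue fst i 0 (layer (cols_ge t ((j, l) :: o)) A) =
    (t <= l) * (c < j) + queue fst i 0 (layer (cols_ge t o) (rem c A)).
  case: (leqP t l) => tl; first by have [+ _] := step t; rewrite ge_cons // mul1n.
  by rewrite ge_skip // ge_nil // !(layer_no_source _).1.
exists ((c, l) :: as1), A'; split.
- rewrite /= Ec h1 cat_rcons; congr (_, _, _); rewrite -addnA; congr (_ + _).
  under [RHS]eq_bigr do rewrite Q; rewrite big_split /=; congr (_ + _).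
  rewrite -big_distrl /= sum_indicator_leq //; clear -hl.
  by case: (c < j); lia.
- rewrite /=; apply: perm_trans (_ : perm_eq (c :: rem c A) A); first by rewrite perm_cons.
  by rewrite perm_sym perm_to_rem.
- by rewrite /= h3.
move=> t; case: (leqP t l) => tl.
  by rewrite !ge_cons //; have [_] := step t; apply; rewrite h4.
rewrite !ge_skip // !ge_nil // (layer_no_source _).2.
by apply: eq_filter => x; rewrite in_nil andbF orbF.
Qed.

End TwoRows.

Hypothesis ballcols_anti : forall r, 0 < r < size B ->
  size (ballcols n B r.+1) <= size (ballcols n B r).

(** One row further down, the balls of label at least [t] are replaced by the places they occupy.
    Fresh balls, labelled by their row, matter only for the new lowest threshold; there the whole
    row takes part, so that term is a count on the full column word and joins the second sum. *)
Lemma fm_from_wraps L i (lab : seq (nat * nat)) : i < size B -> i < L ->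
  perm_eq (map fst lab) (ballcols n B i.+1) -> all (fun a => i < a.2 <= L) lab ->
  fm_from n B i.+1 lab =
  \sum_(i.+1 <= t < L.+1) wraps fst i
     [seq x <- C | (x.1 <= i) || (x.1 == i.+1) && (x.2 \in cols_ge t lab)] +
  \sum_(0 <= j < i) wraps fst j C.
Proof.
elim: i lab => [|i IH] lab iB iL plab hlab; first by rewrite big1 // big_geq.
pose o := sort (fun a b => b.2 <= a.2) (sort (fun a b => a.1 <= b.1) lab).
have po : perm_eq o lab.
  by rewrite /o !perm_sort.
have ge_o t : cols_ge t o =i cols_ge t lab.
  by apply/perm_mem/perm_map/perm_filter.
have pfo : perm_eq (map fst o) (ballcols n B i.+2).
  by apply: perm_trans plab; apply: perm_map.
have hi : 0 < i.+1 < size B by rewrite iB.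
have uo : uniq (map fst o).
  by rewrite (perm_uniq pfo) filter_uniq ?iota_uniq.
have [||||as1 [A' [E pA sn hpk]]] := fm_loop hi (L := L) [::] 0
    (sorted_ballcols i.+1) (fun _ => id) uo _ _ _ _.
- by move=> z; rewrite (perm_mem pfo).
- by apply: sort_sorted => a b; apply: leq_total.
- by rewrite (perm_all _ po).
- by rewrite -(size_map fst) (perm_size pfo); apply: ballcols_anti.
rewrite (fm_fromSS E) cat0s add0n.
set lab' := as1 ++ _.
have hlab' : all (fun a => i < a.2 <= L) lab'.
  rewrite all_cat; apply/andP; split; apply/allP => a.
    move=> aas; have : a.2 \in map snd o by rewrite -sn map_f.
    by case/mapP => b; rewrite (perm_mem po) => /(allP hlab) hb ->; move: hb; clear; lia.
  by case/mapP => c _ -> /=; rewrite ltnSn ltnW.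
have plab' : perm_eq (map fst lab') (ballcols n B i.+1).
  by rewrite map_cat -map_comp map_id.
rewrite (IH lab') ?(ltnW iB) ?(ltnW iL) //.
rewrite [X in _ + (X + _)]big_ltn; last exact: leqW.
have -> : [seq x <- C | (x.1 <= i) || (x.1 == i.+1) && (x.2 \in cols_ge i.+1 lab')] =
    [seq x <- C | x.1 <= i.+1].
  apply: eq_in_filter => -[r j] xC /=; rewrite [RHS]leq_eqVlt ltnS orbC.
  case: eqP => //= er; rewrite er in xC *.
  have -> : cols_ge i.+1 lab' = map fst lab'.
    by congr map; apply/all_filterP; apply: sub_all hlab' => a /andP[].
  by rewrite (perm_mem plab') mem_ballcols ?xC //; case/andP: hi => _ /ltnW ->.
rewrite wraps_filter // [\sum_(0 <= j < i.+1) _]big_nat_recr //=.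
have R t : i.+1 < t ->
    wraps fst i.+1 [seq x <- C | (x.1 <= i.+1) || (x.1 == i.+2) && (x.2 \in cols_ge t lab)] =
    queue fst i.+1 0 (layer i.+1 (cols_ge t o) (ballcols n B i.+1)) +
    wraps fst i [seq x <- C | (x.1 <= i) || (x.1 == i.+1) && (x.2 \in cols_ge t lab')].
  move=> it.
  have -> : [seq x <- C | (x.1 <= i.+1) || (x.1 == i.+2) && (x.2 \in cols_ge t lab)] =
      layer i.+1 (cols_ge t o) (ballcols n B i.+1).
    apply: eq_in_filter => -[r j] xC /=; rewrite leq_eqVlt ge_o.
    have [er|nr] /= := eqVneq r i.+1; last by rewrite orbF.
    rewrite er in xC *; rewrite mem_ballcols ?xC ?orbT //.
    by case/andP: hi => _ /ltnW ->.
  rewrite /= hpk; congr (_ + wraps _ _ _); apply: eq_filter => x.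
  congr (_ || _ && (_ \in _)); rewrite /cols_ge filter_cat map_cat.
  rewrite (eq_in_filter (a2 := pred0) (s := map _ A')) ?filter_pred0 ?cats0 //.
  by move=> a /mapP[c _ ->] /=; rewrite leqNgt it.
rewrite [X in _ = X + _](eq_big_nat _ _ (F2 := fun t =>
    queue fst i.+1 0 (layer i.+1 (cols_ge t o) (ballcols n B i.+1)) +
    wraps fst i [seq x <- C | (x.1 <= i) || (x.1 == i.+1) && (x.2 \in cols_ge t lab')])).
  by rewrite big_split /= -!addnA; congr (_ + _); rewrite addnC -addnA.
by move=> t /andP[/R].
Qed.

Lemma maj_wraps : maj n B = \sum_(0 <= j < size B) wraps id j (cw n B).
Proof.
under eq_bigr do rewrite wraps_map.
rewrite /maj; case: (posnP (size B)) => [->|B0]; first by rewrite big_geq.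
rewrite -(prednK B0); set i := (size B).-1; have iB : i < size B by rewrite prednK.
rewrite (@fm_from_wraps i.+1) //; first last.
- by apply/allP => a /mapP[c _ ->]; rewrite /= ltnSn.
- by rewrite -map_comp map_id.
(* On the top row every label is the number of rows, so a single threshold remains and it selects
   the whole row. *)
rewrite big_nat1 big_nat_recr //= addnC; congr (_ + wraps _ _ _).
rewrite -[RHS]filter_predT; apply: eq_in_filter => -[r j] xC /=.
have := xC; rewrite mem_cw_cells /= => /and3P[/andP[_ rB] _ _].
have [er|nr] := eqVneq r i.+1; last first.
  by rewrite orbF -ltnS ltn_neqAle nr /i prednK.
rewrite /cols_ge; set u := filter _ _.
have -> : u = [seq (c, i.+1) | c <- ballcols n B i.+1].
  by apply/all_filterP/allP => a /mapP[c _ ->] /=.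
rewrite -map_comp map_id mem_ballcols -?er ?xC ?orbT //.
by rewrite rB er.
Qed.

End FerrariMartin.

(** * Row counts of multiline queues and the conclusion *)

Lemma size_ballcols n B r : is_matrix n B -> 0 < r <= size B ->
  size (ballcols n B r) = count id (brow B r).
Proof.
move=> mB /andP[r0 rB].
have sz : size (brow B r) = n by apply/eqP/(allP mB)/mem_nth; rewrite prednK.
rewrite size_filter -[in RHS](mkseq_nth false (brow B r)) sz count_map.
by rewrite -(addn0 1) iotaDl count_map.
Qed.

Lemma conjp_anti la j : conjp la j.+1 <= conjp la j.
Proof. by apply: sub_count => x /ltnW. Qed.

Lemma MLQ_count la n M j : is_MLQ la n M -> 0 < j <= size M ->
  count id (brow M j) = conjp la j.
Proof.
move=> /and3P[/eqP sM _ /allP hM] hj; apply/eqP/hM; rewrite mem_iota -sM.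
by move: hj; clear; lia.
Qed.

Lemma partition_content_cw la n M : is_MLQ la n M -> partition_content (cw n M).
Proof.
move=> hM; have /and3P[_ mM _] := hM; split.
  by apply/allP => x /mapP[c]; rewrite mem_cw_cells => /and3P[/andP[c0 _] _ _] ->.
move=> j j0; have [jM|jM] := leqP j.+1 (size M).
  by rewrite !count_cw ?j0 ?(ltnW jM) // !(MLQ_count hM) ?j0 ?(ltnW jM) // conjp_anti.
rewrite (count_memPn _) //; apply/mapP => -[c]; rewrite mem_cw_cells.
by case/and3P => /andP[_ cM] _ _ e; move: jM; rewrite e ltnNge cM.
Qed.

Theorem theorem4p9 (la : seq nat) (n : nat) (M : seq (seq bool)) :
  is_partition la -> size la <= n -> is_MLQ la n M ->
  maj n M = charge_tab (rho_Q n M).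
Proof.
move=> _ _ hM; have /and3P[_ mM _] := hM.
have [T tT kn] := knuth_tableau (cw n M).
(* Both sides become sums of wraps, of [cw n M] and of [rrw T]; these words are Knuth equivalent, so
   the sums agree level by level. *)
rewrite /charge_tab (rrw_rho_Q mM tT kn) maj_wraps; last first.
  move=> r /andP[r0 rM]; rewrite !size_ballcols ?r0 ?(ltnW rM) //.
  by rewrite !(MLQ_count hM) ?r0 ?(ltnW rM) // conjp_anti.
have pT := knuth_perm kn; have [pos hc] := partition_content_cw hM.
rewrite (@charge_wraps (size M)); first 1 last.
- split; first by rewrite -(perm_all _ pT).
  by move=> j j0; rewrite -!(permP pT); apply: hc.
- rewrite -(perm_all _ pT); apply/allP => x /mapP[c]; rewrite mem_cw_cells.
  by case/and3P => /andP[_ cM] _ _ ->.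
by apply: eq_bigr => i _; apply/local_wraps/knuth_local.
Qed.
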